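(* Let $(C,F,D,G)$ be the data of a hybrid inclusion on $\mathbb R^n$ satisfying the Hybrid Basic Conditions. Then the $\omega$-limit set $K:=\omega(\psi)$ of every (bounded, complete) vanishing inflation solution $\psi$ of the hybrid inclusion is nonempty, compact, weakly invariant, and internally chain transitive (with respect to $\mathcal S_{\mathcal H}$), and thus internally $\mathcal S^c_{\mathcal H|_K}$-chain transitive.
   Context: $\mathbb B$ is the closed unit ball. A hybrid time domain is the union of a nondecreasing sequence of compact hybrid time domains, i.e. sets $\bigcup_{i=0}^{J-1}[t_i,t_{i+1}]\times\{i\}$ with $J\ge1$, $0=t_0\le\dots\le t_J$. A hybrid arc is a function $\phi:\mathrm{dom}\,\phi\to\mathbb R^n$ on a hybrid time domain such that $t\mapsto\phi(t,j)$ is absolutely continuous on $[t,t']$ whenever $(t,j),(t',j)\in\mathrm{dom}\,\phi$, $t<t'$; it is complete if its domain is unbounded. The tail $\phi^{(s,i)}$, $(s,i)\in\mathrm{dom}\,\phi$, has domain $\{(t,j)\in[0,\infty)^2:(s+t,i+j)\in\mathrm{dom}\,\phi\}$ and values $\phi(s+t,i+j)$. Hybrid inclusion with data $(C,F,D,G)$: $x\in C,\ \dot x\in F(x)$; $x\in D,\ x^+\in G(x)$, with $C,D\subset\mathbb R^n$, $F,G:\mathbb R^n\rightrightarrows\mathbb R^n$. Hybrid Basic Conditions: $C,D$ closed; $F,G$ outer semicontinuous and locally bounded; $F(x)$ nonempty and convex for all $x\in C$; $G(x)$ nonempty for all $x\in D$. A solution is a hybrid arc $\phi$ with $\phi(0,0)\in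 C\cup D$ such that: whenever $[t,t']\times\{j\}\subset\mathrm{dom}\,\phi$ with $t<t'$, $\phi(r,j)\in C$ and $\dot\phi(r,j)\in F(\phi(r,j))$ for almost all $r\in[t,t']$; whenever $(t,j),(t,j+1)\in\mathrm{dom}\,\phi$, $\phi(t,j)\in D$ and $\phi(t,j+1)\in G(\phi(t,j))$. $\mathcal S_{\mathcal H}$ is the set of all solutions. For $\varepsilon>0$ the $\varepsilon$-inflated system is the hybrid inclusion with data $C_\varepsilon=C+\varepsilon\mathbb B$, $F_\varepsilon(x)=\overline{\mathrm{co}}\,F((x+\varepsilon\mathbb B)\cap C)+\varepsilon\mathbb B$ for $x\in C_\varepsilon$, $D_\varepsilon=D+\varepsilon\mathbb B$, $G_\varepsilon(x)=G((x+\varepsilon\mathbb B)\cap D)+\varepsilon\mathbb B$ for $x\in D_\varepsilon$. For a complete, bounded hybrid arc $\psi$, $\mathcal P(\psi)$ is the class of functions $\chi:\mathrm{dom}\,\chi\to\mathbb R^n$ such that (i) $\mathrm{dom}\,\chi=\{(s,i,t,j):(s,i),(t,j)\in\mathrm{dom}\,\psi,\ s+i\le t+j\}$; (ii) if $(s,i,t_1,j),(s,i,t_2,j)\in\mathrm{dom}\,\chi$ with $t_2>t_1$, then $t\mapsto\chi(s,i,t,j)$ is absolutely continuous on $[t_1,t_2]$; (iii) for each $\tau>0$, $\lim_{s+i\to\infty}\sup\{|\chi(s,i,t,j)|:(s,i,t,j)\in\mathrm{dom}\,\chi,\ 0\le t+j-(s+i)\le\tau\}=0$. A complete, bounded hybrid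 arc $\psi$ is a vanishing inflation solution if there exists $\chi\in\mathcal P(\psi)$ and, for each $\varepsilon>0$ and $T>0$, there exists $\kappa>0$ such that, for each $(s,i)\in\mathrm{dom}\,\psi$ with $s+i\ge\kappa$, the mapping with domain $\mathrm{dom}\,\psi^{(s,i)}\cap\{(t,j)\in\mathbb R_{\ge0}\times\mathbb Z_{\ge0}:t+j\le T\}$ and values $\psi^{(s,i)}(t,j)+\chi(s,i,s+t,i+j)$ is a solution of the $\varepsilon$-inflated system. $\omega(\psi)=\{z:\exists (t_n,j_n)\in\mathrm{dom}\,\psi,\ t_n+j_n\to\infty,\ \psi(t_n,j_n)\to z\}$. A set $K$ is weakly invariant if for every $x\in K$ and $T>0$ there exists a complete $\phi\in\mathcal S_{\mathcal H}$ with range in $K$ such that $\phi(t,j)=x$ for some $(t,j)\in\mathrm{dom}\,\phi$ with $t+j\ge T$. For a set $\mathcal L$ of hybrid arcs, $K$ is internally $\mathcal L$-chain transitive if for every $x,y\in K$ and $\tau,\varepsilon>0$ there exist $k^*\ge1$, points $x=x_0,\dots,x_{k^*}=y$, arcs $\phi_0,\dots,\phi_{k^*-1}\in\mathcal L$ and $(t_k,j_k)\in\mathrm{dom}\,\phi_k$ with $t_k+j_k\ge\tau$ such that $\phi_k(0,0)=x_k$, $x_{k+1}\in\phi_k(t_k,j_k)+\varepsilon\mathbb B$, and $\phi_k(t,j)\in K$ for all $(t,j)\in\mathrm{dom}\,\phi_k$ with $t+j\le t_k+j_k$; ''internally chain transitive'' means with $\mathcal L=\mathcal S_{\mathcal H}$.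 $\mathcal H|_K$ is the hybrid inclusion with data $(C\cap K,F,D\cap K,G^K)$, $G^K(x)=G(x)\cap K$, and $\mathcal S^c_{\mathcal H|_K}$ is the set of its complete solutions. *)

(* Defs.v *)
From HB Require Import structures.
From mathcomp Require Import all_boot all_order all_algebra.
From mathcomp Require Import all_classical all_reals all_analysis.

Set Implicit Arguments.
Unset Strict Implicit.
Unset Printing Implicit Defensive.

Import Order.TTheory GRing.Theory Num.Theory.
Import numFieldNormedType.Exports.

Local Open Scope classical_set_scope.
Local Open Scope ring_scope.

(** * Euclidean geometry of R^n *)

(* The library norm on ['rV[R]_n] is the max norm; it induces the same
   topology and the same bounded sets, but balls are Euclidean below. *)
Definition enorm (R : realType) (n : nat) (x : 'rV[R]_n) : R :=
  Num.sqrt (\sum_(i < n) x ord0 i ^+ 2).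

Definition unit_ball (R : realType) (n : nat) : set 'rV[R]_n :=
  [set b | enorm b <= 1].

(* A + e B *)
Definition inflate (R : realType) (n : nat) (A : set 'rV[R]_n) (e : R) :
    set 'rV[R]_n :=
  [set a + e *: b | a in A & b in @unit_ball R n].

Definition convex (R : realType) (n : nat) (A : set 'rV[R]_n) : Prop :=
  @convex_set R 'rV[R]_n A.

Definition closed_convex_hull (R : realType) (n : nat) (A : set 'rV[R]_n) :
    set 'rV[R]_n :=
  closure (smallest (@convex R n) A).

(* epsilon-delta absolute continuity on [a, b], with finite families of
   nonoverlapping subintervals *)
Definition absolutely_continuous (R : realType) (n : nat)
    (f : R -> 'rV[R]_n) (a b : R) : Prop :=
  forall e : R, 0 < e -> exists2 d : R, 0 < d &
    forall (m : nat) (u v : nat -> R),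
      (forall i, (i < m)%N -> a <= u i /\ u i <= v i /\ v i <= b) ->
      trivIset `I_m (fun i => `]u i, v i[%classic) ->
      \sum_(i < m) (v i - u i) < d ->
      \sum_(i < m) enorm (f (v i) - f (u i)) < e.

(** * Set-valued maps *)

Definition outer_semicontinuous (R : realType) (n : nat)
    (F : 'rV[R]_n -> set 'rV[R]_n) : Prop :=
  forall (x y : 'rV[R]_n) (u v : nat -> 'rV[R]_n),
    u @ \oo --> x -> v @ \oo --> y -> (forall k, F (u k) (v k)) -> F x y.

Definition locally_bounded (R : realType) (n : nat)
    (F : 'rV[R]_n -> set 'rV[R]_n) : Prop :=
  forall x : 'rV[R]_n, exists2 U, nbhs x U & bounded_set (\bigcup_(z in U) F z).

(** * Hybrid time domains and hybrid arcs *)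

Definition compact_hybrid_time_domain (R : realType) (E : set (R * nat)) :
    Prop :=
  exists (J : nat) (t : nat -> R),
    [/\ (1 <= J)%N, t 0%N = 0,
        (forall i, (i < J)%N -> t i <= t i.+1) &
        E = \bigcup_(i in `I_J) (`[t i, t i.+1]%classic `*` [set i])].

Definition hybrid_time_domain (R : realType) (E : set (R * nat)) : Prop :=
  exists A : nat -> set (R * nat),
    [/\ (forall k, compact_hybrid_time_domain (A k)),
        (forall k, A k `<=` A k.+1) &
        E = \bigcup_k A k].

(* Partial functions on hybrid time: the values of [hval] outside [hdom]
   are junk, and nothing below depends on them. *)
Record hybrid_map (R : realType) (n : nat) := HybridMap {
  hdom : set (R * nat);
  hval :> R -> nat -> 'rV[R]_n
}.

Definition hybrid_arc (R : realType) (n : nat) (phi : hybrid_map R n) : Prop :=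
  hybrid_time_domain (hdom phi) /\
  forall (t t' : R) (j : nat), hdom phi (t, j) -> hdom phi (t', j) -> t < t' ->
    absolutely_continuous (phi^~ j) t t'.

Definition complete_map (R : realType) (n : nat) (phi : hybrid_map R n) : Prop :=
  forall M : R, exists t j, hdom phi (t, j) /\ M < t + j%:R.

Definition bounded_map (R : realType) (n : nat) (phi : hybrid_map R n) : Prop :=
  bounded_set [set phi p.1 p.2 | p in hdom phi].

Definition tail (R : realType) (n : nat) (phi : hybrid_map R n)
    (s : R) (i : nat) : hybrid_map R n :=
  HybridMap [set p | 0 <= p.1 /\ hdom phi (s + p.1, (i + p.2)%N)]
            (fun t j => phi (s + t) (i + j)%N).

(** * Hybrid inclusions *)

Record hybrid_inclusion (R : realType) (n : nat) := HybridInclusion {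
  flow_set : set 'rV[R]_n;
  flow_map : 'rV[R]_n -> set 'rV[R]_n;
  jump_set : set 'rV[R]_n;
  jump_map : 'rV[R]_n -> set 'rV[R]_n
}.

Definition hybrid_basic_conditions (R : realType) (n : nat)
    (H : hybrid_inclusion R n) : Prop :=
  [/\ closed (flow_set H) /\ closed (jump_set H),
      outer_semicontinuous (flow_map H) /\ locally_bounded (flow_map H),
      outer_semicontinuous (jump_map H) /\ locally_bounded (jump_map H),
      (forall x, flow_set H x -> flow_map H x !=set0 /\ convex (flow_map H x)) &
      (forall x, jump_set H x -> jump_map H x !=set0)].

(* The two-sided derivative at a point of the open interval ]t, t'[ only sees
   values of [phi^~ j] inside the domain; the endpoints are a null set. *)
Definition is_solution (R : realType) (n : nat) (H : hybrid_inclusion R n)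
    (phi : hybrid_map R n) : Prop :=
  [/\ hybrid_arc phi,
      (flow_set H `|` jump_set H) (phi 0 0%N),
      (forall (t t' : R) (j : nat), t < t' ->
         `[t, t']%classic `*` [set j] `<=` hdom phi ->
         {ae @lebesgue_measure R, forall r : R, t <= r <= t' ->
           [/\ flow_set H (phi r j),
               derivable (phi^~ j) r 1 &
               flow_map H (phi r j) (derive1 (phi^~ j) r)]}) &
      (forall (t : R) (j : nat), hdom phi (t, j) -> hdom phi (t, j.+1) ->
         jump_set H (phi t j) /\ jump_map H (phi t j) (phi t j.+1))].

Definition solutions (R : realType) (n : nat) (H : hybrid_inclusion R n) :
    set (hybrid_map R n) :=
  [set phi | is_solution H phi].

Definition complete_solutions (R : realType) (n : nat)
    (H : hybrid_inclusion R n) : set (hybrid_map R n) :=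
  [set phi | is_solution H phi /\ complete_map phi].

(* No restriction of the two maps to C_e and D_e is needed: outside these sets
   the formulas give the empty set. *)
Definition inflation (R : realType) (n : nat) (H : hybrid_inclusion R n)
    (e : R) : hybrid_inclusion R n :=
  HybridInclusion
    (inflate (flow_set H) e)
    (fun x => inflate (closed_convex_hull
       (\bigcup_(z in inflate [set x] e `&` flow_set H) flow_map H z)) e)
    (inflate (jump_set H) e)
    (fun x => inflate
       (\bigcup_(z in inflate [set x] e `&` jump_set H) jump_map H z) e).

Definition restriction (R : realType) (n : nat) (H : hybrid_inclusion R n)
    (K : set 'rV[R]_n) : hybrid_inclusion R n :=
  HybridInclusion (flow_set H `&` K) (flow_map H)
                  (jump_set H `&` K) (fun x => jump_map H x `&` K).

(** * Vanishing inflation solutions *)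

Definition perturbation_dom (R : realType) (n : nat) (psi : hybrid_map R n) :
    set (R * nat * R * nat) :=
  [set q | let: (s, i, t, j) := q in
     [/\ hdom psi (s, i), hdom psi (t, j) & s + i%:R <= t + j%:R]].

(* The supremum is taken in the extended reals, so that it is infinite when the
   set is unbounded. *)
Definition perturbation_sup (R : realType) (n : nat) (psi : hybrid_map R n)
    (chi : R -> nat -> R -> nat -> 'rV[R]_n) (tau s : R) (i : nat) : \bar R :=
  ereal_sup [set (enorm (chi s i p.1 p.2))%:E | p in
    [set p : R * nat | perturbation_dom psi (s, i, p.1, p.2) /\
       0 <= p.1 + p.2%:R - (s + i%:R) <= tau]].

(* As for hybrid maps, [chi s i t j] is junk outside [perturbation_dom psi]. *)
Definition vanishing_perturbation (R : realType) (n : nat)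
    (psi : hybrid_map R n) (chi : R -> nat -> R -> nat -> 'rV[R]_n) : Prop :=
  (forall (s : R) (i : nat) (t1 t2 : R) (j : nat),
     perturbation_dom psi (s, i, t1, j) -> perturbation_dom psi (s, i, t2, j) ->
     t1 < t2 -> absolutely_continuous (fun t => chi s i t j) t1 t2) /\
  (forall tau : R, 0 < tau -> forall e : R, 0 < e ->
     exists M : R, forall (s : R) (i : nat),
       hdom psi (s, i) -> M <= s + i%:R ->
       (perturbation_sup psi chi tau s i < e%:E)%E).

Definition vanishing_inflation_solution (R : realType) (n : nat)
    (H : hybrid_inclusion R n) (psi : hybrid_map R n) : Prop :=
  [/\ hybrid_arc psi, complete_map psi, bounded_map psi &
    exists2 chi, vanishing_perturbation psi chi &
      forall e T : R, 0 < e -> 0 < T ->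
        exists2 kappa : R, 0 < kappa &
          forall (s : R) (i : nat), hdom psi (s, i) -> kappa <= s + i%:R ->
            is_solution (inflation H e)
              (HybridMap
                 (hdom (tail psi s i) `&` [set p | p.1 + p.2%:R <= T])
                 (fun t j => tail psi s i t j + chi s i (s + t) (i + j)%N))].

(** * Limit sets, invariance, chain transitivity *)

Definition omega_limit (R : realType) (n : nat) (psi : hybrid_map R n) :
    set 'rV[R]_n :=
  [set z | exists (t : nat -> R) (j : nat -> nat),
     [/\ (forall k, hdom psi (t k, j k)),
         t k + (j k)%:R @[k --> \oo] --> +oo &
         psi (t k) (j k) @[k --> \oo] --> z]].

Definition weakly_invariant (R : realType) (n : nat)
    (H : hybrid_inclusion R n) (K : set 'rV[R]_n) : Prop :=
  forall (x : 'rV[R]_n) (T : R), K x -> 0 < T ->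
    exists phi : hybrid_map R n,
      [/\ solutions H phi, complete_map phi,
          (forall t j, hdom phi (t, j) -> K (phi t j)) &
          exists t j, [/\ hdom phi (t, j), T <= t + j%:R & phi t j = x]].

Definition internally_chain_transitive (R : realType) (n : nat)
    (L : set (hybrid_map R n)) (K : set 'rV[R]_n) : Prop :=
  forall (x y : 'rV[R]_n) (tau e : R), K x -> K y -> 0 < tau -> 0 < e ->
    exists (m : nat) (z : nat -> 'rV[R]_n) (phi : nat -> hybrid_map R n)
           (t : nat -> R) (j : nat -> nat),
      [/\ (1 <= m)%N, z 0%N = x, z m = y &
          forall k, (k < m)%N ->
            [/\ L (phi k) /\ phi k 0 0%N = z k,
                hdom (phi k) (t k, j k),
                tau <= t k + (j k)%:R,
                inflate [set phi k (t k) (j k)] e (z k.+1) &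
                forall (r : R) (l : nat), hdom (phi k) (r, l) ->
                  r + l%:R <= t k + (j k)%:R -> K (phi k r l)]].

(* Main.v *)
Require Import Defs.
From HB Require Import structures.
From mathcomp Require Import all_boot all_order all_algebra.
From mathcomp Require Import all_classical all_reals all_analysis.
From mathcomp Require Import measurable_realfun ring lra.

Set Implicit Arguments.
Unset Strict Implicit.
Unset Printing Implicit Defensive.

Import Order.TTheory GRing.Theory Num.Theory.
Import numFieldNormedType.Exports.

Local Open Scope classical_set_scope.
Local Open Scope ring_scope.

(** The theorem rests on one compactness principle, [tail_limit]: tails of psi that
start later and later converge to complete solutions of H whose range is in the
omega-limit set K.

For this the perturbed tails psi + chi, which solve inflated inclusions on
bounded windows with inflation radius tending to 0, are studied in
[solution_limit]. Limits are taken pointwise along an ultrafilter, along which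
every bounded family converges. A complete hybrid time domain is the same thing
as a nondecreasing sequence of jump times in [0, +oo] ([complete_domainP]); the
jump times of the tails converge, and the limits are the jump times of the
limit. Since F is locally bounded, the perturbed tails are Lipschitz with a
common constant, by a mean value inequality for absolutely continuous arcs
([mean_value_ae]); hence the limit arc is Lipschitz, and differentiable almost
everywhere ([lipschitz_ae_derivable]). That it satisfies the differential
inclusion follows from the same inequality applied on short intervals: the
velocities of the perturbed tails are there close to F(phi(r)), which is convex,
so the difference quotients and then the derivative of the limit are close to it
([limit_arc_flow_map]). Jumps pass to the limit because the graph of G is closed.

Weak invariance of K follows by taking tails that start T before times where psi
is near x. For chain transitivity, psi itself is followed from near x to near y:
by [uniform_shadowing] every late piece of psi is shadowed by a solution in K,
and consecutive pieces give solutions whose ends nearly match. Solutions with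
range in K are solutions of the restriction of H to K, whence the last
assertion. *)

(** * Lipschitz functions of a real variable are differentiable a.e. *)

(** Each half-open interval has Stieltjes mass at most [c] times its length, so
covers of small total length have small total mass. *)
Lemma stieltjes_null (R : realType) (g : cumulative R R) (c : R) :
  0 < c -> (forall x y, x <= y -> g y - g x <= c * (y - x)) ->
  forall A : set R, lebesgue_measure A = 0%E ->
    lebesgue_stieltjes_measure g A = 0%E.
Proof.
move=> c0 gc A A0; apply/eqP; rewrite eq_le; apply/andP; split; last first.
  exact: mu_ext_ge0.
apply/lee_addgt0Pr => e e0; rewrite add0e.
have : (lebesgue_measure A < (e / c)%:E)%E by rewrite A0 lte_fin divr_gt0.
rewrite /lebesgue_measure/= /lebesgue_stieltjes_measure/= /measure_extension/=.
move=> /ereal_inf_lt[_ [B [mB AB] <-] Be].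
apply: (@le_trans _ _ (\sum_(0 <= i <oo) wlength g (B i))%E).
  by apply: ereal_inf_lbound; exists B.
have le i : (wlength g (B i) <= c%:E * wlength idfun (B i))%E.
  have /ocitvP[->|[[u v] /= /ltW uv ->]] := mB i.
    by rewrite !wlength0 mule0.
  by rewrite !wlength_itv_bnd//= -EFinM lee_fin gc.
apply: (@le_trans _ _ (\sum_(0 <= i <oo) c%:E * wlength idfun (B i))%E).
  by apply: lee_nneseries.
rewrite nneseriesZl//.
by rewrite muleC -lee_pdivlMr// ltW.
Qed.

(** By [stieltjes_null] the Stieltjes measure of [g] is dominated by the Lebesgue
measure, so that [g] is locally an indefinite integral of its Radon-Nikodym
density, and the Lebesgue differentiation theorem applies. *)
Lemma lipschitz_nondecreasing_derivable (R : realType) (g : R -> R) (c : R) :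
  0 < c -> {homo g : x y / x <= y} ->
  (forall x y, x <= y -> g y - g x <= c * (y - x)) ->
  {ae @lebesgue_measure R, forall x, derivable g x 1}.
Proof.
move=> c0 gnd gc.
have cg : continuous g.
  move=> x; apply/(@cvgrPdist_lt _ R^o) => e e0.
  near=> y; have yx : `|x - y| < e / c.
    near: y; apply: (@cvgr_dist_lt _ R^o _ _ _ id x); last exact: divr_gt0.
    exact: cvg_id.
  rewrite ltr_pdivlMr// in yx; apply: le_lt_trans yx.
  have [xy|/ltW yx] := leP x y.
    rewrite !ler0_norm ?subr_le0 ?gnd// !opprB mulrC; exact: gc.
  rewrite !ger0_norm ?subr_ge0 ?gnd// mulrC; exact: gc.
have grc : right_continuous g by exact: right_continuousW.
pose cu := isCumulative.Build R _ R g gnd grc.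
pose g' : cumulative R R := HB.pack g cu.
have key (N : nat) : {ae @lebesgue_measure R, forall x,
   - N%:R < x -> x < N%:R -> derivable g x 1}.
  pose D : set (measurableTypeR R) := `]- N%:R, N%:R]%classic.
  have mD : measurable D by exact: measurable_itv.
  pose LS : {measure set (measurableTypeR R) -> \bar R} := lebesgue_stieltjes_measure g'.
  have LSoc (a b : R) : a <= b -> LS `]a, b]%classic = (g b - g a)%:E.
    move=> ab; rewrite -(wlength_itv_bnd g' false false ab).
    by apply: measurable_mu_extE; exact: is_ocitv.
  have LSD : (LS D < +oo)%E.
    by rewrite LSoc ?ltry//; apply: (@le_trans _ _ 0); rewrite ?oppr_le0.
  pose nu : {finite_measure set (measurableTypeR R) -> \bar R} := mfrestr mD LSD.
  have nudom : charge_of_finite_measure nu `<<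
      (@lebesgue_measure R : set (measurableTypeR R) -> \bar R).
    apply/null_content_dominatesP => A mA A0.
    apply/eqP; rewrite eq_le measure_ge0 andbT.
    rewrite -(stieltjes_null (g := g') c0 gc A0).
    by apply: le_measure; rewrite ?inE//; exact: measurableI.
  pose h := Radon_Nikodym (charge_of_finite_measure nu) (@lebesgue_measure R).
  have ih : (@lebesgue_measure R).-integrable setT h by exact: Radon_Nikodym_integrable.
  have hfin x : h x \is a fin_num by exact: Radon_Nikodym_fin_num.
  have ihf : (@lebesgue_measure R).-integrable setT (EFin \o (fine \o h)).
    by apply: eq_integrable ih => // x _ /=; rewrite fineK.
  have ifA (A : set R) : measurable A ->
      (@lebesgue_measure R).-integrable A (EFin \o (fine \o h)).
    by move=> mA; apply: integrableS ihf.
  have := @FTC1 R (fine \o h) (BRight (- N%:R)).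
  move=> /(_ (fun y => ifA _ (measurable_itv _))).
  have loc : locally_integrable [set: R] (fine \o h).
    apply: open_integrable_locally => //; exact: openT.
  move=> /(_ loc); apply: filterS; first exact: (ae_filter_ringOfSetsType lebesgue_measure).
move=> x Hx Nx xN.
  have {Hx} [Hx _] := Hx Nx.
  have -> : g = (fun y => (g y - g (- N%:R)) + g (- N%:R)).
    by apply/funext => y; rewrite subrK.
  apply: derivableD; last exact: derivable_cst.
  apply: near_eq_derivable Hx.
  have xI : x \in `]- N%:R, N%:R[ by rewrite in_itv/= Nx xN.
  near=> y; have : y \in `]- N%:R, N%:R[ by near: y; exact: near_in_itvoo.
  rewrite in_itv/= => /andP[Ny yN].
  rewrite /Rintegral -[RHS]/(fine (g y - g (- N%:R))%:E); congr fine.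
  rewrite -LSoc; last exact: ltW.
  have -> : LS `]- N%:R, y]%classic = nu `]- N%:R, y]%classic.
    rewrite /nu /= /mfrestr /mrestr; congr (LS _); rewrite setIidl//.
    by apply: subset_itvl; rewrite bnd_simp ltW.
  rewrite -[RHS]/(charge_of_finite_measure nu _) (Radon_Nikodym_integral nudom)//.
  by apply: eq_integral => t _ /=; rewrite fineK.
have : {ae @lebesgue_measure R, forall x, forall N : nat,
   - N%:R < x -> x < N%:R -> derivable g x 1}.
  exact/ae_foralln/key.
apply: filterS; first exact: (ae_filter_ringOfSetsType lebesgue_measure).
move=> x /(_ (Num.bound `|x|)).
have := archi_boundP (normr_ge0 x); rewrite ltr_norml => /andP[Nx xN].
by apply.
Unshelve. all: by end_near. Qed.

(** Adding [c * x] with a large [c] makes a Lipschitz function nondecreasing. *)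
Lemma lipschitz_ae_derivable (R : realType) (f : R -> R) (L : R) :
  (forall x y, `|f x - f y| <= L * `|x - y|) ->
  {ae @lebesgue_measure R, forall x, derivable f x 1}.
Proof.
move=> fL.
pose c := `|L| + 1; have c0 : 0 < c by rewrite ltr_wpDl.
have fc x y : x <= y -> `|f y - f x| <= c * (y - x).
  move=> xy; apply: le_trans (fL _ _) _; rewrite ger0_norm ?subr_ge0//.
  by rewrite ler_wpM2r ?subr_ge0// (le_trans (ler_norm _))// lerDl.
have : {ae @lebesgue_measure R, forall x, derivable (fun x => f x + c * x) x 1}.
  apply: (@lipschitz_nondecreasing_derivable _ _ (c + c)).
  - exact: addr_gt0.
  - move=> x y xy; have := fc _ _ xy; rewrite ler_norml => /andP[+ _].
    lra.
  - move=> x y xy; have := fc _ _ xy; rewrite ler_norml => /andP[_ +].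
    lra.
apply: filterS; first exact: (ae_filter_ringOfSetsType lebesgue_measure).
move=> x dx.
have -> : f = (fun x => f x + c * x) \- (fun x => c * x).
  by apply/funext => y /=; rewrite addrK.
by apply: derivableB => //; apply: derivableM => //; exact: derivable_id.
Qed.

(** * A mean value inequality for absolutely continuous arcs *)

(** All estimates below are in the max norm; this lemma and [enorm_le] are the
only bridges to the Euclidean norm. *)
Lemma norm_le_enorm (R : realType) (n : nat) (x : 'rV[R]_n) : `|x| <= enorm x.
Proof.
rewrite -[`|x|]/(mx_norm x) mx_normrE.
apply: bigmax_le => [|[i j] _]; first exact: sqrtr_ge0.
rewrite /= ord1 -sqrtr_sqr ler_wsqrtr// (bigD1 j)//= lerDl.
by apply: sumr_ge0 => k _; exact: sqr_ge0.
Qed.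

Lemma coord_le_norm (R : realType) (n : nat) (x : 'rV[R]_n) j : `|x ord0 j| <= `|x|.
Proof.
rewrite -[leRHS]/(mx_norm x) mx_normrE.
exact: (le_bigmax _ (fun p : 'I_1 * 'I_n => `|x p.1 p.2|) (ord0, j)).
Qed.

Lemma enorm_le (R : realType) (n : nat) (x : 'rV[R]_n) :
  enorm x <= n%:R * `|x|.
Proof.
rewrite /enorm -[leRHS]ger0_norm ?mulr_ge0//.
rewrite -sqrtr_sqr ler_wsqrtr// exprMn.
apply: (@le_trans _ _ (\sum_(i < n) `|x| ^+ 2)).
  apply: ler_sum => i _; rewrite -real_normK ?num_real//.
  by rewrite ler_sqr ?nnegrE// coord_le_norm.
rewrite sumr_const card_ord -[leLHS]mulr_natl ler_wpM2r ?sqr_ge0// -natrX ler_nat.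
by case: n x => [//|n] x; rewrite expnS expn1 leq_pmulr.
Qed.

Lemma convexP (R : realType) (n : nat) (A : set 'rV[R]_n) : convex A ->
  forall (x y : 'rV[R]_n) (t : R), A x -> A y -> 0 <= t -> t <= 1 ->
  A (t *: x + (1 - t) *: y).
Proof.
move=> cA x y t Ax Ay t0 t1.
have := cA x y (Itv01 t0 t1); rewrite !inE => /(_ Ax Ay).
by [].
Qed.

Lemma convex_cone (R : realType) (n : nat) (A : set 'rV[R]_n) : convex A ->
  forall (x y : 'rV[R]_n) (l m : R), A x -> A y -> 0 <= l -> 0 <= m ->
  exists2 z, A z & l *: x + m *: y = (l + m) *: z.
Proof.
move=> cA x y l m Ax Ay l0 m0.
have [lm|lm] := eqVneq (l + m) 0.
  exists x => //; have [-> ->] : l = 0 /\ m = 0 by lra.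
  by rewrite addr0 !scale0r addr0.
have lm0 : 0 < l + m by rewrite lt_neqAle eq_sym lm addr_ge0.
exists ((l / (l + m)) *: x + (1 - l / (l + m)) *: y).
  apply: convexP => //; first by rewrite divr_ge0// ltW.
  by rewrite ler_pdivrMr// mul1r lerDl.
rewrite scalerDr !scalerA; congr (_ *: _ + _ *: _); field => //.
Qed.

(** Cousin's principle: the supremum of the points [x] such that [P a x] cannot
be smaller than [b]. It replaces the choice of a fine tagged partition, so that
no sum over such a partition has to be written. *)
Lemma cousin (R : realType) (a b : R) (P : R -> R -> Prop) : a < b ->
  (forall u v w, u < v -> v < w -> P u v -> P v w -> P u w) ->
  (forall r, a <= r <= b -> exists2 d, 0 < d &
     forall u v, a <= u -> u <= r -> r <= v -> v <= b -> u < v -> v - u < d ->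
     P u v) ->
  P a b.
Proof.
move=> ab Padd Ploc.
pose S := [set x | a <= x <= b /\ (x = a \/ P a x)].
have Sa : S a by split; [rewrite lexx ltW|left].
have supS : has_sup S.
  by split; [exists a|exists b => x [/andP[]]].
pose c := sup S.
have ac : a <= c by exact: sup_upper_bound.
have cb : c <= b by apply: sup_le_ub; [exists a|move=> x [/andP[]]].
have [d d0 Pd] : exists2 d, 0 < d & forall u v, a <= u -> u <= c -> c <= v ->
   v <= b -> u < v -> v - u < d -> P u v by apply: Ploc; rewrite ac cb.
have [x [/andP[ax xb] Px] cx] := sup_adherent d0 supS.
rewrite -/c in cx.
have xc : x <= c by apply: sup_upper_bound => //; split => //; rewrite ax xb.
pose w := c + (d - (c - x)) / 2.
have cw : c < w by rewrite /w; lra.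
have step v : c <= v -> v <= b -> x < v -> v - x < d -> S v.
  move=> cv vb xv vxd; have Pxv : P x v by exact: Pd.
  split; first by rewrite vb (le_trans ac cv).
  right; case: Px => [<-//|Pax].
  have [axe|xa] := eqVneq x a; first by rewrite -axe.
  by apply: (Padd a x v) => //; rewrite lt_neqAle eq_sym xa.
have [bw|wb] := leP b w; last first.
  have : S w by apply: step; rewrite /w in cw wb *; lra.
  by move=> /(sup_upper_bound supS); rewrite -/c leNgt cw.
have [xb'|bx] := ltP x b.
  have [_ [ba|//]] : S b by apply: step; rewrite ?/w in bw *; lra.
  by move: ab; rewrite ba ltxx.
have xeb : x = b by apply/le_anti; rewrite xb bx.
by move: Px; rewrite xeb => -[ba|//]; move: ab; rewrite ba ltxx.
Qed.

Section interval_chains.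
Variable R : realType.
Implicit Types (u v w : R) (s : seq (R * R)).

(** A finite family of nonoverlapping intervals in [[u, v]], listed from left to
right, in a form that is stable under concatenation. *)
Fixpoint chain u s v : Prop :=
  if s is p :: s' then u <= p.1 /\ p.1 <= p.2 /\ chain p.2 s' v else u <= v.

Lemma chain_le u s v : chain u s v -> u <= v.
Proof.
elim: s u => [//|p s IH] u /= [up [pp /IH]].
by move/(le_trans pp)/(le_trans up).
Qed.

Lemma chain_cat u v w s1 s2 : chain u s1 v -> chain v s2 w ->
  chain u (s1 ++ s2) w.
Proof.
elim: s1 u => [|p s IH] u /=.
  case: s2 => [|q s2] /=; first exact: le_trans.
  by move=> uv [vq qs]; split => //; apply: le_trans vq.
by move=> [up [pp ps]] c2; split=> //; split => //; exact: IH.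
Qed.

Lemma chain_nth u s v i : chain u s v -> (i < size s)%N ->
  [/\ u <= (nth (0, 0) s i).1, (nth (0, 0) s i).1 <= (nth (0, 0) s i).2
    & (nth (0, 0) s i).2 <= v].
Proof.
elim: s u i => [//|p s IH] u [|i] /= [up [pp ps]].
  by split=> //; exact: chain_le ps.
rewrite ltnS => /(IH _ _ ps)[h1 h2 h3]; split => //.
by apply: le_trans h1; apply: le_trans up _.
Qed.

Lemma chain_nth_lt u s v i j : chain u s v -> (i < j)%N -> (j < size s)%N ->
  (nth (0, 0) s i).2 <= (nth (0, 0) s j).1.
Proof.
elim: s u i j => [//|p s IH] u i [//|j] /= [up [pp ps]].
case: i => [|i]; rewrite !ltnS => ij js /=.
  by have [] := chain_nth ps js.
exact: IH ps ij js.
Qed.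

Lemma chain_trivIset u s v : chain u s v ->
  trivIset setT (fun i => `](nth (0, 0) s i).1, (nth (0, 0) s i).2[%classic).
Proof.
move=> ch; apply/trivIsetP => i j _ _.
wlog ij : i j / (i < j)%N.
  move=> h /[dup] + ij; rewrite neq_ltn => /orP[/h -> //|/h].
  by rewrite setIC => ->//; rewrite eq_sym.
move=> _; have [js|js] := ltnP j (size s); last first.
  by rewrite [X in _ `&` X]set_itv_ge ?setI0// bnd_simp nth_default//= ltxx.
apply/seteqP; split=> // x [] /=; rewrite !in_itv/= => /andP[_ xi] /andP[jx _].
have := chain_nth_lt ch ij js.
by rewrite leNgt (lt_trans jx xi).
Qed.

Lemma chain_measure u s v (O : set R) : chain u s v -> measurable O ->
  (forall p, p \in s -> `]p.1, p.2[%classic `<=` O) ->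
  ((\sum_(p <- s) (p.2 - p.1))%:E <= lebesgue_measure O)%E.
Proof.
move=> ch mO sO.
pose A i := `](nth (0, 0) s i).1, (nth (0, 0) s i).2[%classic.
have -> : (\sum_(p <- s) (p.2 - p.1))%:E =
          lebesgue_measure (\big[setU/set0]_(i < size s) A i).
  rewrite measure_bigsetU; last 2 first.
  - by move=> i; exact: measurable_itv.
  - exact: chain_trivIset ch.
  rewrite (big_nth (0, 0)) big_mkord -sumEFin; apply: eq_bigr => i _.
  have [_ le _] := chain_nth ch (ltn_ord i).
  rewrite [X in _ = X](_ : _ =
    lebesgue_measure [set` `](nth (0, 0) s i).1, (nth (0, 0) s i).2[])//.
  rewrite lebesgue_measure_itv/= lte_fin.
  case: ltP => [//|le'].
  by rewrite (@le_anti _ _ (nth (0, 0) s i).1 (nth (0, 0) s i).2) ?le// subrr.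
apply: le_measure; rewrite ?inE//.
  by apply: bigsetU_measurable => i _; exact: measurable_itv.
rewrite -bigcup_mkord => x [i /= si]; apply: sO.
exact: mem_nth.
Qed.

End interval_chains.

Lemma derivable_increment (R : realType) (n : nat) (f : R -> 'rV[R]_n) (r e : R) :
  derivable f r 1 -> 0 < e -> exists2 d, 0 < d & forall h, `|h| < d ->
    `|f (r + h) - f r - h *: derive1 f r| <= e * `|h|.
Proof.
move=> df e0.
have : (fun h => h^-1 *: ((f \o shift r) (h *: 1) - f r)) @ 0^' -->
    derive1 f r.
  by rewrite derive1E.
move=> /cvgrPdist_le /(_ _ e0) [d /= d0 Hd]; exists d => // h hd.
have [->|h0] := eqVneq h 0; first by rewrite addr0 subrr scale0r subr0 !normr0 mulr0.
have := Hd h; rewrite /= sub0r normrN [_%:A]mulr1 => /(_ hd h0) H.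
have -> : f (r + h) - f r - h *: derive1 f r =
   - (h *: (derive1 f r - h^-1 *: (f (h + r) - f r))).
  by rewrite scalerBr scalerA divff// scale1r opprB (addrC r).
by rewrite normrN normrZ mulrC ler_wpM2r.
Qed.

Lemma absolutely_continuous_chain (R : realType) (n : nat) (f : R -> 'rV[R]_n)
    (a b e : R) :
  absolutely_continuous f a b -> 0 < e ->
  exists2 d, 0 < d & forall s, chain a s b -> \sum_(p <- s) (p.2 - p.1) < d ->
    `|\sum_(p <- s) (f p.2 - f p.1)| <= e.
Proof.
move=> acf e0; have [d d0 Hd] := acf e e0; exists d => // s ch sd.
have := Hd (size s) (fun i => (nth (0, 0) s i).1) (fun i => (nth (0, 0) s i).2).
have H i : (i < size s)%N -> a <= (nth (0, 0) s i).1 /\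
   (nth (0, 0) s i).1 <= (nth (0, 0) s i).2 /\ (nth (0, 0) s i).2 <= b.
  by move=> /(chain_nth ch)[].
move=> /(_ H (sub_trivIset (@subsetT _ _) (chain_trivIset ch))).
move: sd; rewrite !(big_nth (0, 0)) !big_mkord => sd /(_ sd) /ltW; apply: le_trans.
apply: le_trans (ler_norm_sum _ _ _) _.
by apply: ler_sum => i _; exact: norm_le_enorm.
Qed.

(** Around a point where the derivative exists and lies in [S], an increment is
the length of the interval times an element of [S], up to a small proportion of
that length. The exceptional points lie in an open set of small measure, and
absolute continuity makes the increments over intervals in that set negligible.
Cousin's principle assembles both kinds of intervals. *)
Lemma mean_value_ae (R : realType) (n : nat) (f : R -> 'rV[R]_n) (a b M : R)
    (S : set 'rV[R]_n) (s0 : 'rV[R]_n) :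
  a < b -> absolutely_continuous f a b -> convex S -> S s0 ->
  (forall s, S s -> `|s| <= M) ->
  {ae @lebesgue_measure R, forall r, a <= r <= b ->
     derivable f r 1 /\ S (derive1 f r)} ->
  forall e, 0 < e -> exists2 s, S s & `|f b - f a - (b - a) *: s| <= e.
Proof.
move=> ab acf cS Ss0 SM [N [mN N0 subN]] e0 e0_gt0.
have M0 : 0 <= M by apply: le_trans (SM _ Ss0).
(* The three errors come from the good intervals, from the increments over the
   bad intervals, and from their total length times an element of [S]. *)
pose K := (b - a) + 1 + M.
have K0 : 0 < K by rewrite /K; lra.
pose e := e0 / K; have e_gt0 : 0 < e by exact: divr_gt0.
have [d d_gt0 Hd] := absolutely_continuous_chain acf e_gt0.
have de : 0 < Num.min d e by rewrite lt_min d_gt0.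
have N0oo : (lebesgue_measure N < +oo)%E by rewrite N0.
have [U [oU NU]] := lebesgue_regularity_outer mN N0oo de.
have mU : measurable U by exact: open_measurable.
move=> UNde.
have Ude : (lebesgue_measure U < (Num.min d e)%:E)%E.
  have := measureDI (@lebesgue_measure R) mU mN.
  rewrite (@subset_measure0 _ _ _ (@lebesgue_measure R) (U `&` N) N)//; last first.
    exact: measurableI.
  by rewrite adde0 => ->.
(* [s] lists the bad intervals, [l] is the total length of the good ones and [z]
   the mean of the derivatives chosen on them. *)
pose P u v := a <= u -> v <= b -> exists s : seq (R * R), exists l : R, exists2 z, S z &
  [/\ chain u s v, (forall p, p \in s -> `]p.1, p.2[%classic `<=` U),
      0 <= l, l + \sum_(p <- s) (p.2 - p.1) = v - u &
      `|f v - f u - \sum_(p <- s) (f p.2 - f p.1) - l *: z| <= e * l].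
have : P a b.
  apply: cousin => //.
  - move=> u v w uv vw Puv Pvw au wb.
    have [|s1 [l1 [z1 Sz1 [ch1 sU1 l10 ls1 H1]]]] := Puv au; first by lra.
    have [||s2 [l2 [z2 Sz2 [ch2 sU2 l20 ls2 H2]]]] := Pvw; [lra..|].
    have [z Sz zE] := convex_cone cS Sz1 Sz2 l10 l20.
    exists (s1 ++ s2), (l1 + l2), z => //; split.
    + exact: chain_cat ch1 ch2.
    + by move=> p; rewrite mem_cat => /orP[/sU1|/sU2].
    + exact: addr_ge0.
    + by rewrite big_cat/=; lra.
    + rewrite -zE big_cat/= mulrDr; apply: le_trans (lerD H1 H2).
      apply: le_trans (ler_normD _ _); rewrite le_eqVlt; apply/orP; left; apply/eqP.
      congr `|_|; set A1 := \sum_(p <- s1) _; set A2 := \sum_(p <- s2) _.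
      rewrite !opprD !addrA.
      apply/rowP => i; rewrite !mxE; ring.
  - move=> r rab; have [rN|rN] := pselect (N r).
      have [d' /= d'0 Hd'] : nbhs r U by apply: open_nbhs_nbhs; split => //; exact: NU.
      exists d' => // u v au ur rv vb uv uvd _ _.
      exists [:: (u, v)], 0, s0 => //; split => //=.
      + by split => //; split; first exact: ltW.
      + move=> p; rewrite inE => /eqP -> x /=; rewrite in_itv/= => /andP[ux xv].
        by apply: Hd'; rewrite /= ltr_norml; apply/andP; split; lra.
      + by rewrite add0r big_seq1.
      + by rewrite big_seq1 /= subrr scale0r subrr normr0 mulr0.
    have [df Sdf] : derivable f r 1 /\ S (derive1 f r).
      by apply: contrapT => H; apply: rN; apply: subN => /= /(_ rab).
    have [d' d'0 Hd'] := derivable_increment df e_gt0.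
    exists d' => // u v au ur rv vb uv uvd _ _.
    exists [::], (v - u), (derive1 f r) => //; split => //=.
    + exact: ltW.
    + by rewrite subr_ge0 ltW.
    + by rewrite big_nil addr0.
    + rewrite big_nil subr0.
      have H1 := Hd' (v - r); have H2 := Hd' (u - r).
      rewrite !subrKC in H1 H2; rewrite ger0_norm ?subr_ge0// in H1.
      rewrite ler0_norm ?subr_le0// in H2.
      have {}H1 := H1 ltac:(lra); have {}H2 := H2 ltac:(lra).
      have -> : f v - f u - (v - u) *: derive1 f r =
        (f v - f r - (v - r) *: derive1 f r) - (f u - f r - (u - r) *: derive1 f r).
        by apply/rowP => i; rewrite !mxE; ring.
      apply: le_trans (ler_normB _ _) _; apply: le_trans (lerD H1 H2) _.
      by rewrite -mulrDr; apply: ler_wpM2l; [exact: ltW|lra].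
case=> // s [l [z Sz [ch sU l0 ls H]]]; exists z => //.
have : ((\sum_(p <- s) (p.2 - p.1))%:E < (Num.min d e)%:E)%E.
  by apply: le_lt_trans Ude; exact: chain_measure ch mU sU.
rewrite lte_fin lt_min => /andP[sd se].
have {Hd} Hd := Hd _ ch sd.
set A := \sum_(p <- s) (f p.2 - f p.1) in H Hd.
have -> : f b - f a - (b - a) *: z = (f b - f a - A - l *: z) + A -
   (\sum_(p <- s) (p.2 - p.1)) *: z.
  by rewrite -ls; apply/rowP => i; rewrite !mxE; ring.
have s_ge0 : 0 <= \sum_(p <- s) (p.2 - p.1).
  rewrite (big_nth (0, 0)) big_mkord sumr_ge0// => i _.
  by have [_ le _] := chain_nth ch (ltn_ord i); rewrite subr_ge0.
apply: le_trans (ler_normB _ _) _; rewrite normrZ (ger0_norm s_ge0).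
apply: (@le_trans _ _ (e * (b - a) + e + e * M)); last first.
  by rewrite -[X in _ + X + _]mulr1 -!mulrDr /e divfK// gt_eqF.
apply: lerD.
  apply: le_trans (ler_normD _ _) _; apply: lerD => //.
  by apply: le_trans H _; apply: ler_wpM2l; [exact: ltW|lra].
by apply: ler_pM => //; [exact: ltW|exact: SM].
Qed.

Lemma lipschitz_ae_derivable_row (R : realType) (n : nat) (f : R -> 'rV[R]_n)
    (L : R) :
  (forall x y, `|f x - f y| <= L * `|x - y|) ->
  {ae @lebesgue_measure R, forall x, derivable f x 1}.
Proof.
move=> fL.
have H (i : 'I_n) : {ae @lebesgue_measure R, forall x,
    derivable (fun t => f t ord0 i) x 1}.
  apply: (@lipschitz_ae_derivable _ _ L) => x y; apply: le_trans (fL x y).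
  by have := coord_le_norm (f x - f y) i; rewrite !mxE.
have : {ae @lebesgue_measure R, forall x, forall i : 'I_n,
    derivable (fun t => f t ord0 i) x 1}.
  apply: filter_forall => //; exact: (ae_filter_ringOfSetsType lebesgue_measure).
apply: filterS; first exact: (ae_filter_ringOfSetsType lebesgue_measure).
by move=> x Hx; apply/derivable_mxP => i j; rewrite (ord1 i).
Qed.

Lemma ae_exists (R : realType) (a b : R) (P : R -> Prop) : a < b ->
  {ae @lebesgue_measure R, forall r, a <= r <= b -> P r} ->
  exists2 r, a <= r <= b & P r.
Proof.
move=> ab [N [mN N0 PN]]; apply: contrapT => nP.
have : (lebesgue_measure `[a, b]%classic <= @lebesgue_measure R N)%E.
  apply: le_measure; rewrite ?inE//.
  move=> r /=; rewrite in_itv/= => rab; apply: PN => /= /(_ rab) Pr.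
  by apply: nP; exists r.
have := @lebesgue_measure_itv R `[a, b]; rewrite /= lte_fin ab => ->.
by rewrite N0 -EFinB lee_fin; lra.
Qed.

Lemma lipschitz_absolutely_continuous (R : realType) (n : nat) (f : R -> 'rV[R]_n)
    (L a b : R) : 0 <= L -> (forall x y, `|f x - f y| <= L * `|x - y|) ->
  absolutely_continuous f a b.
Proof.
move=> L0 fL e e0; pose K := n%:R * L + 1.
have K0 : 0 < K by rewrite ltr_wpDl ?mulr_ge0.
exists (e / K); first exact: divr_gt0.
move=> m u v uv _ sd.
apply: (@le_lt_trans _ _ (K * \sum_(i < m) (v i - u i))); last first.
  by rewrite mulrC -ltr_pdivlMr.
rewrite mulr_sumr; apply: ler_sum => i _.
have [_ [uvi _]] := uv i (ltn_ord i).
have uvi0 : 0 <= v i - u i by rewrite subr_ge0.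
apply: le_trans (enorm_le _) _.
apply: (@le_trans _ _ (n%:R * L * (v i - u i))).
  rewrite -mulrA ler_wpM2l// (le_trans (fL _ _))// ger0_norm//.
by rewrite ler_wpM2r// /K lerDl.
Qed.

(** * Limits along an ultrafilter *)

Lemma fmap_ultra (I T : Type) (f : I -> T) (U : set_system I) :
  UltraFilter U -> UltraFilter (f @ U).
Proof.
move=> UU; split; first exact: fmap_proper_filter.
move=> G FG sG; apply/seteqP; split=> // A GA.
have [//|UnA] := in_ultra_setVsetC (f @^-1` A) UU.
have GnA : G (~` A) by apply: sG.
have : G set0 by rewrite -(setICr A); exact: filterI.
by move=> /(@filter_not_empty _ G).
Qed.

Lemma ultra_compact (I : Type) (T : topologicalType) (U : set_system I)
    (f : I -> T) (A : set T) : UltraFilter U -> compact A ->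
  U (f @^-1` A) -> exists2 l, A l & f @ U --> l.
Proof.
move=> UU; rewrite compact_ultra => /(_ _ (fmap_ultra f UU)) H /H[l [Al fl]].
by exists l.
Qed.

Section ultralimits.
Variables (R : realType) (I : Type) (U : set_system I).
Hypothesis UU : UltraFilter U.

(** Along an ultrafilter every bounded family converges. This is why limits of
solutions can be defined pointwise, without extracting subsequences. *)
Lemma ultra_lim_row (n : nat) (f : I -> 'rV[R]_n) (M : R) :
  (\forall k \near U, `|f k| <= M) ->
  exists l, forall e, 0 < e -> \forall k \near U, `|f k - l| < e.
Proof.
move=> fM; have [|l _ fl] := @ultra_compact _ _ U f [set x | `|x| <= M] UU _ fM.
  apply: bounded_closed_compact.
    by exists M; split; [exact: num_real|] => x Mx y /= /le_trans; apply; exact: ltW.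
  apply: (@preimage_closed _ _ (@Num.norm R 'rV[R]_n) [set t | t <= M]).
    by move=> x _; exact: norm_continuous.
  exact: closed_le.
by exists l => e e0; move/cvgr_distC_lt: fl; exact.
Qed.

Lemma ultra_lim_itv (f : I -> R) (a b : R) :
  (\forall k \near U, a <= f k <= b) ->
  exists2 l, a <= l <= b & forall e, 0 < e -> \forall k \near U, `|f k - l| < e.
Proof.
move=> fM; have [|l] := @ultra_compact _ _ U f `[a, b]%classic UU (@segment_compact _ _ _).
  by apply: filterS fM => k /=; rewrite in_itv.
rewrite /= in_itv/= => lab fl; exists l => // e e0.
by move/cvgr_distC_lt: fl; exact.
Qed.

Lemma near_and (P Q : set I) : U P -> U Q -> U (P `&` Q).
Proof. exact: filterI. Qed.

Lemma near_ex (P : set I) : U P -> exists k, P k.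
Proof. exact: filter_ex. Qed.

Lemma ultra_near_or (P Q : I -> Prop) : (\forall k \near U, P k \/ Q k) ->
  (\forall k \near U, P k) \/ (\forall k \near U, Q k).
Proof.
move=> PQ; have [|nP] := in_ultra_setVsetC [set k | P k] UU; [by left|right].
by apply: filterS (filterI PQ nP) => k [[]].
Qed.

Lemma ultra_near_bounded_nat (j : I -> nat) (N : nat) :
  (\forall k \near U, (j k <= N)%N) -> exists i, \forall k \near U, j k = i.
Proof.
elim: N => [|N IH] jN.
  by exists 0%N; apply: filterS jN => k; rewrite leqn0 => /eqP.
have : \forall k \near U, (j k <= N)%N \/ j k = N.+1.
  by apply: filterS jN => k; rewrite leq_eqVlt => /orP[/eqP|]; [right|left].
by move=> /ultra_near_or[/IH|h] //; exists N.+1.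
Qed.

Lemma ultralimit_unique (n : nat) (f : I -> 'rV[R]_n) (l l' : 'rV[R]_n) :
  (forall e, 0 < e -> \forall k \near U, `|f k - l| < e) ->
  (forall e, 0 < e -> \forall k \near U, `|f k - l'| < e) -> l = l'.
Proof.
move=> Hl Hl'; apply/eqP; rewrite -subr_eq0 -normr_le0.
apply/ler_addgt0Pr => e e0; have e20 : 0 < e / 2 by rewrite divr_gt0.
have [k [h h']] := near_ex (near_and (Hl _ e20) (Hl' _ e20)).
rewrite distrC in h; have := ler_distD (f k) l l'; lra.
Qed.

End ultralimits.

Lemma ultra_infty : exists2 U : set_system nat, UltraFilter U & \oo `<=` U.
Proof. by have [U [UU oU]] := ultraFilterLemma eventually_filter; exists U. Qed.

Lemma near_natSinv (R : realType) (U : set_system nat) (e : R) : \oo `<=` U -> 0 < e ->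
  \forall k \near U, (k.+1%:R^-1 : R) < e.
Proof.
move=> oU e0; apply: oU; near=> k; near: k; exact: near_infty_natSinv_lt (PosNum e0).
Unshelve. all: by end_near. Qed.

Lemma near_nat_ge (R : realType) (U : set_system nat) (N : R) : \oo `<=` U ->
  \forall k \near U, N <= k%:R.
Proof.
move=> oU; apply: oU; near=> k; near: k; exact: nbhs_infty_ger.
Unshelve. all: by end_near. Qed.

Lemma closed_approx (R : realType) (n : nat) (A : set 'rV[R]_n) x : closed A ->
  (forall e, 0 < e -> exists2 a, A a & `|a - x| <= e) -> A x.
Proof.
move=> cA H; apply: cA => B /nbhs_ballP[e /= e0 eB].
have [a Aa ax] := H (e / 2) (divr_gt0 e0 (ltr0n _ 2)).
exists a; split => //; apply: eB; rewrite -ball_normE /= distrC.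
by apply: le_lt_trans ax _; lra.
Qed.

(** * Set-valued maps and inflations *)

Section set_valued_maps.
Variables (R : realType) (n : nat) (F : 'rV[R]_n -> set 'rV[R]_n).

(** Outer semicontinuity as closedness of the graph, in the form in which
approximate membership is obtained below. *)
Lemma outer_semicontinuous_graph (x y : 'rV[R]_n) : outer_semicontinuous F ->
  (forall e, 0 < e -> exists z v, [/\ F z v, `|z - x| <= e & `|v - y| <= e]) ->
  F x y.
Proof.
move=> oF H.
have /choice[zv Hzv] : forall k : nat, exists p : 'rV[R]_n * 'rV[R]_n,
    [/\ F p.1 p.2, `|p.1 - x| <= k.+1%:R^-1 & `|p.2 - y| <= k.+1%:R^-1].
  by move=> k; have [|z [v ?]] := H k.+1%:R^-1; [rewrite invr_gt0|exists (z, v)].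
have cv (w : nat -> 'rV[R]_n) l : (forall k, `|w k - l| <= k.+1%:R^-1) ->
    w @ \oo --> l.
  move=> wl; apply/cvgrPdist_lt => e e0; near=> k.
  rewrite distrC (le_lt_trans (wl k))//.
  by near: k; exact: near_infty_natSinv_lt (PosNum e0).
apply: (oF x y (fun k => (zv k).1) (fun k => (zv k).2)).
- by apply: cv => k; have [] := Hzv k.
- by apply: cv => k; have [] := Hzv k.
- by move=> k; have [] := Hzv k.
Unshelve. all: by end_near. Qed.

Lemma bounded_setP (A : set 'rV[R]_n) : bounded_set A ->
  exists M, forall x, A x -> `|x| <= M.
Proof.
case=> M0 [_ H]; exists (M0 + 1) => x Ax; apply: (H (M0 + 1)) => //.
by rewrite ltrDl.
Qed.

(** Otherwise there are bounded points with values of norm larger than [k] for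
every [k], and local boundedness fails at an ultralimit of these points. *)
Lemma locally_bounded_bounded (M : R) : locally_bounded F ->
  exists L, forall z v, `|z| <= M -> F z v -> `|v| <= L.
Proof.
move=> bF; apply: contrapT => H.
have /choice[zv Hzv] : forall k : nat, exists p : 'rV[R]_n * 'rV[R]_n,
    [/\ `|p.1| <= M, F p.1 p.2 & k%:R < `|p.2|].
  move=> k; apply: contrapT => nk; apply: H; exists k%:R => z v zM Fzv.
  by rewrite leNgt; apply/negP => kv; apply: nk; exists (z, v).
have [U UU oU] := ultra_infty.
have [|z Hz] := @ultra_lim_row _ _ _ UU _ (fun k => (zv k).1) M.
  by apply: nearW => k; have [] := Hzv k.
have [V] := bF z; move=> /nbhs_ballP[e /= e0 eV] /bounded_setP[L HL].
have zV : \forall k \near U, V (zv k).1.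
  apply: filterS (Hz _ e0) => k ze; apply: eV.
  by rewrite -ball_normE /= distrC.
have LU : \forall k \near U, L < k%:R.
  apply: oU; near=> k; near: k; exact: nbhs_infty_gtr.
have [k [Vk Lk]] := filter_ex (filterI zV LU).
have [_ Fk kv] := Hzv k.
have : `|(zv k).2| <= L by apply: HL; exists (zv k).1.
by rewrite leNgt (lt_trans Lk kv).
Unshelve. all: by end_near. Qed.

(** Values of [F] at points tending to [x] are bounded, hence have an ultralimit,
which is in [F x] because the graph is closed: they cannot all stay at distance
more than [eta] from [F x]. *)
Lemma outer_semicontinuous_usc (x : 'rV[R]_n) (eta : R) :
  outer_semicontinuous F -> locally_bounded F -> 0 < eta ->
  exists2 d, 0 < d & forall z v, `|z - x| <= d -> F z v ->
    exists2 w, F x w & `|v - w| <= eta.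
Proof.
move=> oF bF eta0; apply: contrapT => H.
have /choice[zv Hzv] : forall k : nat, exists p : 'rV[R]_n * 'rV[R]_n,
    [/\ `|p.1 - x| <= k.+1%:R^-1, F p.1 p.2 & forall w, F x w -> eta < `|p.2 - w|].
  move=> k; apply: contrapT => nk; apply: H; exists k.+1%:R^-1 => [|z v zx Fzv].
    by rewrite invr_gt0.
  apply: contrapT => nw; apply: nk; exists (z, v); split => // w Fw.
  by rewrite ltNge; apply/negP => vw; apply: nw; exists w.
have [L HL] := locally_bounded_bounded (`|x| + 1) bF.
have [U UU oU] := ultra_infty.
have [|y Hy] := @ultra_lim_row _ _ _ UU _ (fun k => (zv k).2) L.
  apply: nearW => k; have [zx Fk _] := Hzv k; apply: HL Fk.
  rewrite -(subrK x (zv k).1) (le_trans (ler_normD _ _))// addrC lerD2l.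
  by rewrite (le_trans zx)// invf_le1// ler1n.
have Fxy : F x y.
  apply: outer_semicontinuous_graph => // e e0.
  have kU : \forall k \near U, k.+1%:R^-1 < e.
    by apply: oU; near=> k; near: k; exact: near_infty_natSinv_lt (PosNum e0).
  have [k [ke ky]] := filter_ex (filterI kU (Hy e e0)).
  have [zx Fk _] := Hzv k.
  exists (zv k).1, (zv k).2; split => //; last exact: ltW.
  by apply: le_trans zx _; exact: ltW.
have [k ky] := filter_ex (Hy eta eta0).
have [_ _ /(_ _ Fxy)] := Hzv k.
by rewrite ltNge (ltW ky).
Unshelve. all: by end_near. Qed.

End set_valued_maps.

Section inflate.
Variables (R : realType) (n : nat).
Implicit Types (A S : set 'rV[R]_n) (x v : 'rV[R]_n).

Lemma inflate_dist A (e : R) x : 0 <= e -> inflate A e x ->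
  exists2 a, A a & `|x - a| <= e.
Proof.
move=> e0 [a Aa [b b1 <-]]; exists a => //.
rewrite addrC addKr normrZ ger0_norm// ler_piMr//.
by apply: le_trans b1; exact: norm_le_enorm.
Qed.

Lemma dist_inflate A (e : R) x a : 0 < e -> A a -> n%:R * `|x - a| <= e ->
  inflate A e x.
Proof.
move=> e0 Aa xa; exists a => //; exists (e^-1 *: (x - a)); last first.
  by rewrite scalerA divff ?gt_eqF// scale1r subrKC.
rewrite /unit_ball /= (le_trans (enorm_le _))// normrZ ger0_norm ?invr_ge0 ?(ltW e0)//.
by rewrite mulrCA mulrC ler_pdivrMr// mul1r.
Qed.

(** Enough about the closed convex hull for what follows: it stays in every
neighbourhood of a convex set that contains [A]. *)
Lemma closed_convex_hull_dist A S v (eta : R) : convex S -> A `<=` S ->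
  closed_convex_hull A v -> 0 < eta -> exists2 s, S s & `|v - s| <= eta.
Proof.
move=> cS AS clv eta0.
have /clv[s [hs vs]] : nbhs v (ball v eta) by exact: nbhsx_ballx.
exists s; first by apply: hs.
by move: vs; rewrite -ball_normE /= => /ltW.
Qed.

Lemma convexI (A : set 'rV[R]_n) :
  (forall x y t, A x -> A y -> 0 <= t -> t <= 1 -> A (t *: x + (1 - t) *: y)) ->
  convex A.
Proof.
move=> cA x y t; rewrite !inE => Ax Ay.
exact: (cA x y t%:num).
Qed.

Lemma convex_ball (L : R) : convex [set v : 'rV[R]_n | `|v| <= L].
Proof.
apply: convexI => x y t /= xL yL t0 t1.
apply: (le_trans (ler_normD _ _)); rewrite !normrZ.
rewrite !ger0_norm ?subr_ge0//.
have -> : L = t * L + (1 - t) * L by ring.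
by apply: lerD; apply: ler_wpM2l => //; rewrite subr_ge0.
Qed.

Lemma convex_nbhd S (eta : R) : convex S ->
  convex [set v | exists2 s, S s & `|v - s| <= eta].
Proof.
move=> cS; apply: convexI => x y t /= [s Ss xs] [r Sr yr] t0 t1.
exists (t *: s + (1 - t) *: r); first exact: convexP.
have : [set v : 'rV[R]_n | `|v| <= eta] (t *: (x - s) + (1 - t) *: (y - r)).
  by apply: convexP => //; exact: convex_ball.
rewrite /=; congr (`|_| <= _).
by apply/rowP => i; rewrite !mxE; ring.
Qed.

(** How the inflated flow map is used: near [x] it only takes values close to any
convex set [S] that contains the values of the flow map on a small ball. The
summand [eta] pays for the closure of the convex hull. *)
Lemma inflation_flow_dist (H : hybrid_inclusion R n) (e eta : R) x v S :
  0 <= e -> convex S ->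
  (forall z, `|z - x| <= e -> flow_set H z -> flow_map H z `<=` S) ->
  flow_map (inflation H e) x v -> 0 < eta ->
  exists2 s, S s & `|v - s| <= e + eta.
Proof.
move=> e0 cS FS /(inflate_dist e0)[a Aa va] eta0.
have [s Ss as_] : exists2 s, S s & `|a - s| <= eta.
  apply: closed_convex_hull_dist Aa eta0 => // w [z [xz Cz] Fzw].
  by apply: FS Fzw => //; have [_ -> //] := inflate_dist e0 xz.
exists s => //; apply: le_trans (ler_distD a _ _) _; exact: lerD.
Qed.

Lemma inflation_jump_dist (H : hybrid_inclusion R n) (e : R) x v : 0 <= e ->
  jump_map (inflation H e) x v -> exists z w, [/\ jump_set H z, jump_map H z w,
    `|z - x| <= e & `|w - v| <= e].
Proof.
move=> e0 /(inflate_dist e0)[w [z [xz Dz] Gzw] vw].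
exists z, w; split => //; last by rewrite distrC.
by have [_ -> //] := inflate_dist e0 xz.
Qed.

End inflate.

(** * Complete hybrid time domains and their jump times *)

Section jump_times.
Variable R : realType.
Implicit Types (tau : nat -> \bar R) (E : set (R * nat)).

(** [tau j] is the time of the [j]-th jump; from the first jump that never
happens on, all jump times are infinite. *)
Definition jump_times tau := tau 0%N = 0%E /\ forall j, (tau j <= tau j.+1)%E.

Definition jump_domain tau : set (R * nat) :=
  [set p | (tau p.2 <= p.1%:E <= tau p.2.+1)%E].

Lemma jump_times_homo tau : jump_times tau ->
  {homo tau : i j / (i <= j)%N >-> (i <= j)%E}.
Proof.
move=> [_ tau_le]; apply: homo_leq => //; exact: le_trans.
Qed.

Lemma jump_times_ge0 tau j : jump_times tau -> (0 <= tau j)%E.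
Proof. by move=> ht; rewrite -ht.1; exact: jump_times_homo. Qed.

Lemma jump_domain_lt tau s i t j : jump_times tau ->
  jump_domain tau (s, i) -> jump_domain tau (t, j) -> (i < j)%N -> s <= t.
Proof.
move=> ht /andP[/= _ si] /andP[/= jt _] ij; rewrite -lee_fin.
apply: le_trans si _; apply: le_trans jt; exact: jump_times_homo.
Qed.

Lemma jump_domain_sorted tau s i t j : jump_times tau ->
  jump_domain tau (s, i) -> jump_domain tau (t, j) ->
  s + i%:R <= t + j%:R -> s <= t /\ (i <= j)%N.
Proof.
move=> ht si tj le; have [ji|ij|ij] := ltngtP j i.
- have := jump_domain_lt ht tj si ji.
  have : (j%:R : R) < i%:R by rewrite ltr_nat.
  by move=> ? ?; exfalso; lra.
- by split => //; exact: (jump_domain_lt ht si tj ij).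
- by split=> //; rewrite ij in le; lra.
Qed.

(** The level [t + j] increases continuously along flows and by [1] at jumps, so
no window of length [1] is missed. *)
Lemma jump_domain_level tau x t1 j1 : jump_times tau -> 0 <= x ->
  jump_domain tau (t1, j1) -> x <= t1 + j1%:R ->
  exists t j, jump_domain tau (t, j) /\ x <= t + j%:R <= x + 1.
Proof.
move=> ht x0; elim: j1 t1 => [|j IH] t1 tj xt.
  exists x, 0%N; rewrite /jump_domain/= addr0 lexx lerDl ler01; split => //.
  move: tj => /andP[/= _ h]; rewrite ht.1 lee_fin x0/=; apply: le_trans h.
  by rewrite lee_fin; move: xt; rewrite addr0.
have [u uE] : exists u, tau j.+1 = u%:E.
  have := jump_times_ge0 j.+1 ht; case/andP: tj => /=.
  by case: (tau j.+1) => // u _ _ _; exists u.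
case/andP: (tj) => /=; rewrite uE lee_fin => ut1 t1j.
have [xu|ux] := leP x (u + j%:R).
  apply: (IH u) => //; rewrite /jump_domain/= uE lexx andbT -uE; exact: ht.2.
have [xu1|u1x] := leP x (u + j.+1%:R).
  exists u, j.+1; split; last by rewrite xu1 -natr1 /=; lra.
  by rewrite /jump_domain/= uE lexx (le_trans _ t1j).
exists (x - j.+1%:R), j.+1; split; last by rewrite subrK lexx lerDl ler01.
rewrite /jump_domain/= uE lee_fin; apply/andP; split; first lra.
by apply: le_trans t1j; rewrite lee_fin; lra.
Qed.

Lemma jump_domain_unbounded tau M : jump_times tau ->
  exists t j, jump_domain tau (t, j) /\ M < t + j%:R.
Proof.
move=> ht; have [[j jy]|nfin] := pselect (exists j, tau j = +oo%E).
  have [[|m] /eqP my mmin] :=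
    ex_minnP (ex_intro (fun j => tau j == +oo%E) j (introT eqP jy)).
    by move: my; rewrite ht.1.
  have [u uE] : exists u, tau m = u%:E.
    have := jump_times_ge0 m ht; have : tau m != +oo%E.
      by apply/negP => /mmin; rewrite ltnn.
    by case: (tau m) => // u _ _; exists u.
  exists (Num.max u (`|M| + 1)), m; split.
    by rewrite /jump_domain/= my leey uE lee_fin le_max lexx.
  have : `|M| + 1 <= Num.max u (`|M| + 1) by rewrite le_max lexx orbT.
  by have := ler_norm M; have : (0 : R) <= m%:R by []; lra.
pose j := Num.bound `|M|.
have [u uE] : exists u, tau j = u%:E.
  have := jump_times_ge0 j ht; have : tau j <> +oo%E by move=> jy; apply: nfin; exists j.
  by case: (tau j) => // u _ _; exists u.
exists u, j; split; first by rewrite /jump_domain/= -uE lexx ht.2.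
have u0 : 0 <= u by rewrite -lee_fin -uE; exact: jump_times_ge0.
by have := archi_boundP (normr_ge0 M); have := ler_norm M; rewrite -/j; lra.
Qed.

(** The [k]-th compact domain of the exhaustion keeps the points with [t <= k] and
[j <= k]; it has as many intervals as there are [i <= k] with [tau i <= k]. *)
Lemma jump_domain_hybrid tau : jump_times tau -> hybrid_time_domain (jump_domain tau).
Proof.
move=> ht.
exists (fun k => [set p | [/\ jump_domain tau p, p.1 <= k%:R & (p.2 <= k)%N]]); split.
- move=> k.
  pose P i := (k < i)%N || (k%:R%:E < tau i)%E.
  have [|J PJ Jmin] := @ex_minnP P; first by exists k.+1; rewrite /P leqnn.
  pose t i := fine (Order.min (tau i) k%:R%:E).
  have tE i : (t i)%:E = Order.min (tau i) k%:R%:E.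
    have kt : (0 <= Order.min (tau i) k%:R%:E)%E.
      by rewrite le_min jump_times_ge0//= lee_fin.
    by rewrite fineK// ge0_fin_numE// gt_min ltry orbT.
  have iJ i : (i < J)%N = ((i <= k)%N && (tau i <= k%:R%:E)%E).
    have -> : (i <= k)%N && (tau i <= k%:R%:E)%E = ~~ P i.
      by rewrite negb_or -leqNgt -leNgt.
    have [iJ|Ji] := ltnP i J.
      by apply/esym/negP => /Jmin; rewrite leqNgt iJ.
    apply/esym/negbTE; rewrite negbK; case/orP: PJ => [kJ|kJ]; rewrite /P.
      by rewrite (leq_trans kJ Ji).
    by rewrite (lt_le_trans kJ) ?orbT//; exact: jump_times_homo.
  exists J, t; split.
  + rewrite iJ /= ht.1 lee_fin//.
  + by rewrite /t ht.1 min_l ?lee_fin.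
  + move=> i _; rewrite -lee_fin !tE le_min !ge_min lexx orbT andbT.
    by rewrite ht.2.
  + apply/seteqP; split => [[r j] [/= /andP[/= jr rj] rk jk]|[r j] [i /= iJ' [+ ->]]].
      exists j => /=.
        by rewrite iJ jk (le_trans jr).
      split => //=; rewrite in_itv/= -!lee_fin !tE ge_min le_min jr rj/=.
      by rewrite lee_fin.
    rewrite in_itv/= -!lee_fin !tE ge_min le_min.
    move: iJ'; rewrite iJ => /andP[ik ti] /andP[/orP ir /andP[ri rk]].
    rewrite /jump_domain/= ri andbT; split => //.
    by case: ir => // /(le_trans ti).
- move=> k [r j] /= [? rk jk]; split => //=; last exact: leqW.
  by rewrite (le_trans rk)// ler_nat.
- apply/seteqP; split => [[r j] rj|[r j] [k _ [] //]].
  exists (maxn j (Num.bound `|r|)) => //=; split => //=; last exact: leq_maxl.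
  apply: (@le_trans _ _ `|r|); first exact: ler_norm.
  apply: le_trans (ltW (archi_boundP (normr_ge0 r))) _.
  by rewrite ler_nat leq_maxr.
Qed.

Section complete_domain.
Variable E : set (R * nat).
Hypothesis hE : hybrid_time_domain E.

(** Any two points lie in one of the nested compact domains, which reduces the
order properties of a hybrid time domain to the compact case. *)
Lemma hybrid_domain_common p q : E p -> E q ->
  exists (J : nat) (t : nat -> R), [/\ t 0%N = 0,
    (forall i, (i < J)%N -> t i <= t i.+1),
    (forall r i, (i < J)%N -> t i <= r <= t i.+1 -> E (r, i)),
    (p.2 < J)%N /\ t p.2 <= p.1 <= t p.2.+1 &
    (q.2 < J)%N /\ t q.2 <= q.1 <= t q.2.+1].
Proof.
case: hE => A [cA AS EA]; rewrite EA => -[k1 _ k1p] [k2 _ k2q].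
have AS' : {homo A : i j / (i <= j)%N >-> i `<=` j}.
  apply: homo_leq; [exact: subset_refl|by move=> Y X Z; exact: subset_trans|exact: AS].
have {}k1p := AS' _ _ (leq_maxl k1 k2) _ k1p.
have {}k2q := AS' _ _ (leq_maxr k1 k2) _ k2q.
have [J [t [_ t0 tle AE]]] := cA (maxn k1 k2).
exists J, t; split => //.
- move=> r i iJ ri; exists (maxn k1 k2) => //; rewrite AE.
  by exists i => //; split => //=; rewrite in_itv.
- move: k1p; rewrite AE => -[i /= iJ [+ ->]].
  by rewrite in_itv.
- move: k2q; rewrite AE => -[i /= iJ [+ ->]].
  by rewrite in_itv.
Qed.

Lemma hybrid_domain0 : E (0, 0%N).
Proof.
case: hE => A [cA AS ->]; exists 0%N => //.
have [J [t [J0 t0 tle ->]]] := cA 0%N.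
exists 0%N => //=; split => //=.
by rewrite in_itv/= t0 lexx -t0 tle.
Qed.

Lemma hybrid_domain_ge0 r j : E (r, j) -> 0 <= r.
Proof.
move=> Er; have [J [t [t0 tle _ [/= jJ /andP[+ _]] _]]] := hybrid_domain_common Er Er.
apply: le_trans; elim: j jJ {Er} => [_|j IH jJ]; first by rewrite t0.
by apply: le_trans (tle _ (ltnW jJ)); exact: IH (ltnW jJ).
Qed.

Lemma hybrid_domain_convex r1 r2 r j : E (r1, j) -> E (r2, j) -> r1 <= r <= r2 ->
  E (r, j).
Proof.
move=> Er1 Er2 /andP[r1r rr2].
have [J [t [_ _ H [/= jJ /andP[tr1 _]] [_ /= /andP[_ r2t]]]]] :=
  hybrid_domain_common Er1 Er2.
by apply: H => //; rewrite (le_trans tr1)//= (le_trans rr2).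
Qed.

Lemma hybrid_domain_pred r j : E (r, j.+1) ->
  exists r', [/\ E (r', j), E (r', j.+1) & r' <= r].
Proof.
move=> Er; have [J [t [t0 tle H [/= jJ /andP[tr rt]] _]]] := hybrid_domain_common Er Er.
exists (t j.+1); split => //; apply: H => //; rewrite ?lexx ?(ltnW jJ) ?andbT//.
  by rewrite tle// ltnW.
exact: tle.
Qed.

Lemma hybrid_domain_le r1 r2 j : E (r1, j) -> E (r2, j.+1) -> r1 <= r2.
Proof.
move=> Er1 Er2.
have [J [t [_ _ H [_ /= /andP[_ r1t]] [_ /= /andP[tr2 _]]]]] :=
  hybrid_domain_common Er1 Er2.
exact: le_trans r1t tr2.
Qed.

Lemma hybrid_domain_nonempty i j r : (i <= j)%N -> E (r, j) -> exists r', E (r', i).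
Proof.
elim: j r => [|j IH] r; first by rewrite leqn0 => /eqP -> ?; exists r.
rewrite leq_eqVlt => /orP[/eqP -> ?|]; first by exists r.
by rewrite ltnS => ij /hybrid_domain_pred[r' [Er' _ _]]; exact: IH Er'.
Qed.

Hypothesis unbE : forall M : R, exists t j, E (t, j) /\ M < t + j%:R.

(** The jump times are the infima of the slices. The last nonempty slice, if
any, is an unbounded interval because the domain is unbounded. *)
Lemma complete_domainP : exists2 tau, jump_times tau & E = jump_domain tau.
Proof.
pose tau j := ereal_inf [set r%:E | r in [set r | E (r, j)]].
have lo r j : E (r, j) -> (tau j <= r%:E)%E.
  by move=> Er; apply: ereal_inf_lbound; exists r.
have hi r j : E (r, j) -> (r%:E <= tau j.+1)%E.
  move=> Er; apply: le_ereal_inf_tmp => _ [r' Er' <-].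
  by rewrite lee_fin; exact: hybrid_domain_le Er Er'.
have att r j : E (r, j) -> exists2 m, E (m, j) & tau j = m%:E.
  case: j => [_|j /hybrid_domain_pred[m [Em Em' _]]].
    exists 0; first exact: hybrid_domain0.
    apply/eqP; rewrite eq_le (lo _ _ hybrid_domain0)/=.
    by apply: le_ereal_inf_tmp => _ [r' /hybrid_domain_ge0 Er' <-]; rewrite lee_fin.
  by exists m => //; apply/eqP; rewrite eq_le (lo _ _ Em') (hi _ _ Em).
have ht : jump_times tau.
  split.
    have [m Em mE] := att _ _ hybrid_domain0.
    apply/eqP; rewrite eq_le (lo _ _ hybrid_domain0)/=.
    by rewrite mE lee_fin; exact: hybrid_domain_ge0 Em.
  move=> j; apply: le_ereal_inf_tmp => _ [r /hybrid_domain_pred[r' [Er' _ r'r]] <-].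
  by apply: le_trans (lo _ _ Er') _; rewrite lee_fin.
have sub : E `<=` jump_domain tau.
  by move=> [r j] Er; rewrite /jump_domain/= lo//= hi.
exists tau => //; apply/seteqP; split => // -[r j] /andP[/= jr rj].
have [r0 Er0] : exists r0, E (r0, j).
  apply: contrapT => nE; move: jr; rewrite /tau.
  suff -> : [set r'%:E | r' in [set r' | E (r', j)]] = set0 by rewrite ereal_inf0.
  by apply/seteqP; split => // x [r' Er' _]; apply: nE; exists r'.
have [m Em mE] := att _ _ Er0.
rewrite mE lee_fin in jr.
suff [q Eq rq] : exists2 q, E (q, j) & r <= q.
  by apply: hybrid_domain_convex Em Eq _; rewrite jr.
have [[q Eq]|nE] := pselect (exists q, E (q, j.+1)).
  have [q' [Eq' Eq'' _]] := hybrid_domain_pred Eq.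
  by exists q' => //; rewrite -lee_fin (le_trans rj)// lo.
have [q [l [Eq rql]]] := unbE (r + j%:R).
have lj : (l <= j)%N.
  rewrite leqNgt; apply/negP => jl.
  by have [q' ?] := hybrid_domain_nonempty jl Eq; apply: nE; exists q'.
move: lj; rewrite leq_eqVlt => /orP[/eqP lj|lj].
  by rewrite lj in Eq rql; exists q => //; lra.
have qm := jump_domain_lt ht (sub _ Eq) (sub _ Em) lj.
have : (l%:R : R) < j%:R by rewrite ltr_nat.
by clear rj mE; move=> ?; exfalso; lra.
Qed.

End complete_domain.

(** Only the start of the slice that contains [(s, i)] can become negative after
the shift; cutting at [0] makes it the initial time of the tail. *)
Lemma tail_jump_domain tau s i : jump_times tau -> jump_domain tau (s, i) ->
  let tau' j := Order.max 0%E (tau (i + j)%N - s%:E)%E in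
  jump_times tau' /\
  (forall t j, jump_domain tau' (t, j) <->
    0 <= t /\ jump_domain tau (s + t, (i + j)%N)).
Proof.
move=> ht is_i tau'; case/andP: is_i => is_ si; rewrite /= in is_ si; split.
  split; rewrite /tau'.
    by rewrite addn0; apply: max_l; rewrite leeBlDr ?add0e.
  move=> j; rewrite ge_max !le_max lexx/=; apply/orP; right.
  by rewrite addnS leeD2r// ht.2.
move=> t j; rewrite /jump_domain/= /tau' ge_max le_max lee_fin addnS.
rewrite leeBlDr// leeBrDr// -EFinD (addrC t).
split.
  move=> /andP[/andP[t0 h1] h2]; split => //; rewrite h1/=.
  case/orP: h2 => // t0'; have -> : t = 0.
    by apply/le_anti; rewrite t0 andbT -lee_fin.
  rewrite addr0; apply: le_trans si _; apply: jump_times_homo => //.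
  by rewrite ltnS leq_addr.
by move=> [-> /andP[-> ->]]; rewrite orbT.
Qed.

End jump_times.

Section ereal_ultralimits.
Variables (R : realType) (I : Type) (U : set_system I).
Hypothesis UU : UltraFilter U.
Implicit Types (a b : I -> \bar R).

(** The limit of extended reals along an ultrafilter, through the order only. *)
Definition ulim a : \bar R := ereal_sup [set x | \forall k \near U, (x <= a k)%E].

Lemma ulim_gt a x : (x < ulim a)%E -> \forall k \near U, (x < a k)%E.
Proof.
move=> /ereal_sup_gt[y ya xy]; apply: filterS ya => k.
exact: lt_le_trans.
Qed.

Lemma ulim_lt a x : (ulim a < x)%E -> \forall k \near U, (a k < x)%E.
Proof.
move=> ax; have [|xa|//] := @ultra_near_or _ _ UU
  (fun k => (x <= a k)%E) (fun k => (a k < x)%E).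
  by apply: nearW => k; case: leP => _; [left|right].
by move: ax; rewrite ltNge ereal_sup_ubound.
Qed.

Lemma ulim_le a b : (\forall k \near U, (a k <= b k)%E) -> (ulim a <= ulim b)%E.
Proof.
move=> ab; apply: ereal_sup_le => x /= xa.
by apply: filterS (filterI ab xa) => k [ak xk]; exact: le_trans ak.
Qed.

Lemma ulim_cvg (t : I -> R) (l : R) :
  (forall e, 0 < e -> \forall k \near U, `|t k - l| < e) ->
  ulim (fun k => (t k)%:E) = l%:E.
Proof.
move=> tl; apply/eqP; rewrite eq_le; apply/andP; split.
  apply: ge_ereal_sup => y /= yt; apply/lee_addgt0Pr => e e0.
  have [k [yk]] := filter_ex (filterI yt (tl e e0)).
  rewrite ltr_norml => /andP[_ tk]; apply: le_trans yk _.
  by rewrite -EFinD lee_fin; lra.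
apply/lee_addgt0Pr => e e0; rewrite -leeBlDr//.
apply: ereal_sup_ubound => /=; apply: filterS (tl e e0) => k.
rewrite ltr_norml => /andP[tk _].
by rewrite -EFinB lee_fin; lra.
Qed.

End ereal_ultralimits.

Section clamp.
Variable R : realType.
Implicit Types (tau : nat -> \bar R) (t r : R).

(** The nearest point of the [j]-th slice, by which arcs with different domains
can be evaluated at a common time. *)
Definition clamp tau j t : R := fine (Order.min (Order.max (tau j) t%:E) (tau j.+1)).

Lemma clampP tau j : jump_times tau -> (tau j < +oo)%E ->
  exists2 a, tau j = a%:E &
    (tau j.+1 = +oo%E /\ forall t, clamp tau j t = Num.max a t) \/
    (exists b, [/\ a <= b, tau j.+1 = b%:E &
       forall t, clamp tau j t = Num.min (Num.max a t) b]).
Proof.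
move=> ht; have := jump_times_ge0 j ht; have := ht.2 j.
case E : (tau j) => [a| |] // ab _ _; exists a => //.
case E' : (tau j.+1) ab => [b| |] //; last first.
  move=> _; left; split => // t.
  by rewrite /clamp E E' -EFin_max min_l ?leey.
rewrite lee_fin => ab; right; exists b; split => // t.
by rewrite /clamp E E' -EFin_max -EFin_min.
Qed.

Lemma clamp_dom tau j t : jump_times tau -> (tau j < +oo)%E ->
  jump_domain tau (clamp tau j t, j).
Proof.
move=> ht /(clampP ht)[a aE [[bE cE]|[b [ab bE cE]]]].
  by rewrite /jump_domain/= cE aE bE leey lee_fin le_max lexx.
rewrite /jump_domain/= cE aE bE !lee_fin ge_min lexx orbT andbT.
by rewrite le_min ab le_max lexx.
Qed.

Lemma maxr_lip (a t r : R) : `|Num.max a t - Num.max a r| <= `|t - r|.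
Proof.
have h1 := ler_norm (t - r).
have h2 : r - t <= `|t - r| by rewrite distrC ler_norm.
rewrite ler_norml /Num.max; apply/andP.
by case: (ltP a t) => ?; case: (ltP a r) => ?; split; lra.
Qed.

Lemma minr_lip (b t r : R) : `|Num.min t b - Num.min r b| <= `|t - r|.
Proof.
have h1 := ler_norm (t - r).
have h2 : r - t <= `|t - r| by rewrite distrC ler_norm.
rewrite ler_norml /Num.min; apply/andP.
by case: (ltP t b) => ?; case: (ltP r b) => ?; split; lra.
Qed.

Lemma clamp_lip tau j t r : jump_times tau -> (tau j < +oo)%E ->
  `|clamp tau j t - clamp tau j r| <= `|t - r|.
Proof.
move=> ht /(clampP ht)[a aE [[bE cE]|[b [ab bE cE]]]]; rewrite !cE.
  exact: maxr_lip.
by apply: le_trans (minr_lip _ _ _) _; exact: maxr_lip.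
Qed.

Lemma clamp_id tau j t : jump_times tau -> jump_domain tau (t, j) ->
  clamp tau j t = t.
Proof.
move=> ht /andP[/= jt tj]; rewrite /clamp max_r// min_l//.
Qed.

Lemma clamp_le tau j t m : jump_times tau -> (tau j < m%:E)%E ->
  clamp tau j t <= Num.max t m.
Proof.
move=> ht jm; have jy : (tau j < +oo)%E by apply: lt_trans jm _; rewrite ltry.
have [a aE] := clampP ht jy; rewrite aE lte_fin in jm.
have h : Num.max a t <= Num.max t m.
  by rewrite ge_max !le_max lexx (ltW jm) orbT.
case=> [[_ ->//]|[b [_ _ ->]]].
by rewrite ge_min h.
Qed.

Lemma clamp_dist tau j t e : jump_times tau -> 0 < e ->
  (tau j < (t + e)%:E)%E -> ((t - e)%:E < tau j.+1)%E ->
  `|clamp tau j t - t| < e.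
Proof.
move=> ht e0 jt tj; have jy : (tau j < +oo)%E by apply: lt_trans jt _; rewrite ltry.
have [a aE] := clampP ht jy; rewrite aE lte_fin in jt.
case=> [[_ cE]|[b [ab bE cE]]]; rewrite cE ltr_norml.
  by rewrite /Num.max; clear aE cE tj; case: (ltP a t) => ?; apply/andP; split; lra.
rewrite bE lte_fin in tj; clear aE bE cE; rewrite /Num.max /Num.min.
by case: (ltP a t) => ?; [case: (ltP t b)|case: (ltP a b)] => ?; apply/andP; split; lra.
Qed.

End clamp.

(** * Limits of solutions of inflated systems *)

Section solution_limit.
Variables (R : realType) (n : nat) (H : hybrid_inclusion R n).
Hypothesis basic : hybrid_basic_conditions H.
Variables (I : Type) (U : set_system I).
Hypothesis UU : UltraFilter U.
Variables (tau : I -> nat -> \bar R) (x : I -> R -> nat -> 'rV[R]_n) (M : R).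
Hypothesis htau : forall k, jump_times (tau k).

Definition window (k : I) (T : R) : set (R * nat) :=
  jump_domain (tau k) `&` [set p | p.1 + p.2%:R <= T].

Hypothesis approximation_bounded : forall T, \forall k \near U,
  forall t j, window k T (t, j) -> `|x k t j| <= M.
Hypothesis approximation_solution : forall e T, 0 < e -> 0 < T -> \forall k \near U,
  is_solution (inflation H e) (HybridMap (window k T) (x k)).

Lemma approximation_flow e T : 0 < e -> 0 < T -> \forall k \near U,
  forall u v j, u < v ->
  window k T (u, j) -> window k T (v, j) ->
  absolutely_continuous (fun t => x k t j) u v /\
  {ae @lebesgue_measure R, forall r, u <= r <= v ->
     [/\ flow_set (inflation H e) (x k r j), derivable (fun t => x k t j) r 1,
         flow_map (inflation H e) (x k r j) (derive1 (fun t => x k t j) r) &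
         window k T (r, j)]}.
Proof.
move=> e0 T0; apply: filterS (approximation_solution e0 T0).
move=> k [[_ acx] _ fx _] u v j uv wu wv.
split; first exact: acx.
have sub : `[u, v]%classic `*` [set j] `<=` window k T.
  move=> [r i] [/=]; rewrite in_itv/= => /andP[ur rv] ->.
  case: wu => /andP[/= ju _] _; case: wv => /andP[/= _ vj] /= vT.
  split; last by rewrite /=; lra.
  by rewrite /jump_domain/= (le_trans ju) ?lee_fin//= (le_trans _ vj)// lee_fin.
apply: filterS (fx u v j uv sub).
  exact: (ae_filter_ringOfSetsType lebesgue_measure).
move=> r Hr urv; have [? ? ?] := Hr urv; split => //.
by apply: sub; split => //=; rewrite in_itv.
Qed.

(** The flow map is bounded on the bounded set where the approximations live, so
the mean value inequality gives one Lipschitz constant for all of them. *)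
Lemma approximation_lipschitz : exists2 L, 0 <= L & forall T, 0 < T -> \forall k \near U,
  forall u v j, window k T (u, j) -> window k T (v, j) ->
  `|x k u j - x k v j| <= L * `|u - v|.
Proof.
have [_ [_ bF] _ _ _] := basic.
have [L0 HL0] := locally_bounded_bounded (M + 1) bF.
(* One unit for the radius of the inflation, one for the closure of the hull. *)
pose L := `|L0| + 2; have L_ge0 : 0 <= L by rewrite addr_ge0.
exists L => // T T0.
apply: filterS (near_and UU (approximation_flow ltr01 T0)
  (approximation_bounded T)) => k [fk bk].
have lt u v j : u < v -> window k T (u, j) -> window k T (v, j) ->
    `|x k v j - x k u j| <= L * (v - u).
  move=> uv wu wv; have [acx aex] := fk u v j uv wu wv.
  apply/ler_addgt0Pr => e e0.
  have [|||s Ls Hs] := @mean_value_ae _ _ (fun t => x k t j) u v L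
    [set w | `|w| <= L] 0 uv acx (@convex_ball _ _ L) _ _ _ e e0.
  - by rewrite /= normr0.
  - by [].
  - apply: filterS aex; first exact: (ae_filter_ringOfSetsType lebesgue_measure).
    move=> r Hr urv; have [_ dr Fr wr] := Hr urv; split => //=.
    have [||s Ls Hs] := inflation_flow_dist _ (@convex_ball _ _ `|L0|) _ Fr ltr01.
    + exact: ler01.
    + move=> z zx _ w Fzw; apply: le_trans (ler_norm L0).
      apply: HL0 Fzw; rewrite -(subrK (x k r j) z).
      apply: le_trans (ler_normD _ _) _; rewrite addrC; apply: lerD => //.
      exact: bk.
    + rewrite -(subrK s (derive1 _ _)).
      by apply: le_trans (ler_normD _ _) _; rewrite /L addrC; apply: lerD.
  rewrite -(subrK ((v - u) *: s) (_ - _)).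
  apply: le_trans (ler_normD _ _) _; rewrite addrC; apply: lerD => //.
  rewrite normrZ gtr0_norm ?subr_gt0// mulrC ler_wpM2r// subr_ge0 ltW//.
move=> u v j wu wv; have [uv|vu|->] := ltgtP u v.
- by rewrite distrC (distrC u) (gtr0_norm (x := v - u)) ?subr_gt0//; exact: lt.
- by rewrite (gtr0_norm (x := u - v)) ?subr_gt0//; exact: lt.
- by rewrite !subrr !normr0 mulr0.
Qed.

Definition limit_times (j : nat) : \bar R := ulim U (fun k => tau k j).

Lemma limit_timesP : jump_times limit_times.
Proof.
split.
  have -> : limit_times 0%N = ulim U (fun=> 0%:E).
    by congr ulim; apply/funext => k; rewrite (htau k).1.
  by apply: ulim_cvg => e e0; apply: nearW => k; rewrite subrr normr0.
by move=> j; apply: ulim_le; apply: nearW => k; exact: (htau k).2.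
Qed.

(** A slice whose limit starts at a finite time is, near the limit, nonempty and
reaches any given time within a window that does not depend on [k]. *)
Lemma clamp_window j t : (limit_times j < +oo)%E -> exists2 T, 0 < T &
  \forall k \near U, (tau k j < +oo)%E /\
    forall r, r <= t -> window k T (clamp (tau k) j r, j).
Proof.
move=> jy; have [m mj] : exists m, (limit_times j < m%:E)%E.
  have := jump_times_ge0 j limit_timesP; case: (limit_times j) jy => // a _ _.
  by exists (a + 1); rewrite lte_fin ltrDl.
exists (`|Num.max t m| + j%:R + 1); first by rewrite ltr_wpDl ?addr_ge0.
apply: filterS (ulim_lt UU mj) => k jm.
have jy' : (tau k j < +oo)%E by apply: lt_trans jm _; rewrite ltry.
split=> // r rt; split; first exact: clamp_dom.
rewrite /=; have := clamp_le r (htau k) jm.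
have : Num.max r m <= Num.max t m by rewrite ge_max !le_max rt lexx orbT.
have := ler_norm (Num.max t m); lra.
Qed.

Lemma limit_value_exists (p : R * nat) : exists l : 'rV[R]_n,
  (limit_times p.2 < +oo)%E ->
  forall e, 0 < e -> \forall k \near U, `|x k (clamp (tau k) p.2 p.1) p.2 - l| < e.
Proof.
have [jy|nj] := pselect (limit_times p.2 < +oo)%E; last by exists 0.
have [T T0 wT] := clamp_window p.1 jy.
have [|l Hl] := @ultra_lim_row _ _ _ UU _ (fun k => x k (clamp (tau k) p.2 p.1) p.2) M.
  apply: filterS (near_and UU wT (approximation_bounded T)) => k [[_ wk] bk].
  exact/bk/wk.
by exists l.
Qed.

Section limit_arc.
(** Clamping defines the [j]-th piece on all of [R], so that it is Lipschitz on
the whole line and not just on its slice. *)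
Variable limit_value : R -> nat -> 'rV[R]_n.
Hypothesis limit_value_cvg : forall t j, (limit_times j < +oo)%E ->
  forall e, 0 < e ->
  \forall k \near U, `|x k (clamp (tau k) j t) j - limit_value t j| < e.
Local Notation phi := (HybridMap (jump_domain limit_times) limit_value).

Lemma limit_times_fin t j : hdom phi (t, j) -> (limit_times j < +oo)%E.
Proof. by move=> /andP[/= h _]; apply: le_lt_trans h _; rewrite ltry. Qed.

Lemma limit_arc_dom s j t :
  (\forall k \near U, jump_domain (tau k) (s k, j)) ->
  (forall e, 0 < e -> \forall k \near U, `|s k - t| < e) -> hdom phi (t, j).
Proof.
move=> ds st; rewrite /= /jump_domain/= -(ulim_cvg UU st).
by apply/andP; split; apply: ulim_le; apply: filterS ds => k /andP[].
Qed.

Lemma limit_arc_dom_seq t j : hdom phi (t, j) -> exists s : I -> R,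
  (\forall k \near U, jump_domain (tau k) (s k, j)) /\
  (forall e, 0 < e -> \forall k \near U, `|s k - t| < e).
Proof.
move=> tj; exists (fun k => clamp (tau k) j t).
have jy := limit_times_fin tj; have [T T0 wT] := clamp_window t jy.
split; first by apply: filterS wT => k [_ /(_ t (lexx _)) []].
move=> e e0; case/andP: tj => /= jt tj.
have n1 : \forall k \near U, (tau k j < (t + e)%:E)%E.
  by apply: (ulim_lt UU); apply: le_lt_trans jt _; rewrite lte_fin ltrDl.
have n2 : \forall k \near U, ((t - e)%:E < tau k j.+1)%E.
  by apply: (ulim_gt UU); apply: lt_le_trans tj; rewrite lte_fin ltrBlDr ltrDl.
by apply: filterS (near_and UU n1 n2) => k [h1 h2]; exact: clamp_dist.
Qed.

Section lipschitz_limit.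
Variable L : R.
Hypothesis L0 : 0 <= L.
Hypothesis lipx : forall T, 0 < T -> \forall k \near U,
  forall u v j, window k T (u, j) -> window k T (v, j) ->
  `|x k u j - x k v j| <= L * `|u - v|.

(** The arcs are equi-Lipschitz, so convergence at fixed times gives convergence
at convergent times, in particular at the jump times. *)
Lemma limit_arc_value s j t :
  (\forall k \near U, jump_domain (tau k) (s k, j)) ->
  (forall e, 0 < e -> \forall k \near U, `|s k - t| < e) ->
  forall e, 0 < e -> \forall k \near U, `|x k (s k) j - phi t j| < e.
Proof.
move=> ds st e e0; have jy := limit_times_fin (limit_arc_dom ds st).
have [T T0 wT] := clamp_window (t + 1) jy.
pose d := Num.min 1 (e / 2 / (L + 1)).
have d0 : 0 < d by rewrite lt_min ltr01 !divr_gt0// ltr_wpDl.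
have e20 : 0 < e / 2 by rewrite divr_gt0.
have near1 := near_and UU wT (near_and UU ds (st d d0)).
have near2 := near_and UU near1 (near_and UU (limit_value_cvg t jy e20) (lipx T0)).
apply: filterS near2.
move=> k [[[jky wk] [dk sk]] [xk lk]].
have skt : s k <= t + 1.
  have : d <= 1 by rewrite ge_min lexx.
  by move: sk; rewrite ltr_norml => /andP[_]; lra.
have := wk (s k) skt; rewrite clamp_id// => ws.
have wt : window k T (clamp (tau k) j t, j) by apply: wk; lra.
have h1 := lk _ _ _ ws wt.
have h2 : `|s k - clamp (tau k) j t| <= d.
  rewrite -{1}(clamp_id (htau k) dk); apply: le_trans (clamp_lip _ _ (htau k) jky) _.
  exact: ltW.
have h3 : L * d <= e / 2.
  apply: (@le_trans _ _ ((L + 1) * d)); first by rewrite ler_wpM2r ?(ltW d0)// lerDl.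
  by rewrite mulrC -ler_pdivlMr ?ltr_wpDl// ge_min lexx orbT.
have h4 := ler_wpM2l L0 h2.
have h5 := ler_distD (x k (clamp (tau k) j t) j) (x k (s k) j) (phi t j).
lra.
Qed.

Lemma limit_arc_lipschitz j : (limit_times j < +oo)%E ->
  forall t t', `|phi t j - phi t' j| <= L * `|t - t'|.
Proof.
move=> jy t t'; apply/ler_addgt0Pr => e e0.
have e20 : 0 < e / 2 by rewrite divr_gt0.
have [T T0 wT] := clamp_window (Num.max t t') jy.
have [k [[[jky wk] lk] [h1 h2]]] := near_ex UU (near_and UU (near_and UU wT (lipx T0))
   (near_and UU (limit_value_cvg t jy e20) (limit_value_cvg t' jy e20))).
have wt : window k T (clamp (tau k) j t, j) by apply: wk; rewrite le_max lexx.
have wt' : window k T (clamp (tau k) j t', j) by apply: wk; rewrite le_max lexx orbT.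
have h3 := lk _ _ _ wt wt'.
have h4 := ler_wpM2l L0 (clamp_lip t t' (htau k) jky).
have h5 := ler_distD (x k (clamp (tau k) j t) j) (phi t j) (phi t' j).
have h6 := ler_distD (x k (clamp (tau k) j t') j) (x k (clamp (tau k) j t) j) (phi t' j).
rewrite (distrC (phi t j) (x k _ j)) in h5.
lra.
Qed.

Lemma limit_arc_initial : (flow_set H `|` jump_set H) (phi 0 0%N).
Proof.
have init e : 0 < e ->
    exists2 c, (flow_set H `|` jump_set H) c & `|c - phi 0 0%N| <= e.
  move=> e0; have e20 : 0 < e / 2 by rewrite divr_gt0.
  have ds : \forall k \near U, jump_domain (tau k) (0, 0%N).
    by apply: nearW => k; rewrite /jump_domain/= (htau k).1 lexx jump_times_ge0.
  have c0 : forall e, 0 < e -> \forall k \near U, `|(0 : R) - 0| < e.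
    by move=> e' e'0; apply: nearW => k; rewrite subrr normr0.
  have := limit_arc_value ds c0 e20.
  move=> /(near_and UU (approximation_solution e20 ltr01)) /(near_ex UU)[k [[_ CD _ _]]].
  rewrite -[x k 0 0%N]/(HybridMap (window k 1) (x k) 0 0%N) => xk.
  have e2_ge0 := ltW e20.
  case: CD => /(inflate_dist e2_ge0)[c Cc xc]; exists c; [by left| |by right|];
    rewrite /= distrC in xc; rewrite /= in xk;
    have := ler_distD (x k 0 0%N) c (phi 0 0%N); rewrite /=; lra.
apply: closed_approx init; have [[cC cD] _ _ _ _] := basic.
exact: closedU.
Qed.

Lemma interior_dom u j : (limit_times j < u%:E)%E -> (u%:E < limit_times j.+1)%E ->
  \forall k \near U, jump_domain (tau k) (u, j).
Proof.
move=> ju uj; apply: filterS (near_and UU (ulim_lt UU ju) (ulim_gt UU uj)).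
by move=> k [h1 h2]; rewrite /jump_domain/= !ltW.
Qed.

(** One approximation that is close to the limit at both ends of [[r, r + h]], and
at distance at most [L * h + e] from [phi r j] in between, for a common index [k]. *)
Lemma interior_approximation r h j e : 0 < h -> 0 < e ->
  (limit_times j < r%:E)%E -> ((r + h)%:E < limit_times j.+1)%E -> exists k,
  [/\ `|x k r j - phi r j| < e, `|x k (r + h) j - phi (r + h) j| < e &
   absolutely_continuous (fun t => x k t j) r (r + h) /\
   {ae @lebesgue_measure R, forall r', r <= r' <= r + h ->
    [/\ flow_set (inflation H e) (x k r' j), derivable (fun t => x k t j) r' 1,
    flow_map (inflation H e) (x k r' j) (derive1 (fun t => x k t j) r') &
    `|x k r' j - phi r j| <= L * h + e]}].
Proof.
move=> h0 e0 jr rhj; have rh : r < r + h by rewrite ltrDl.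
have rj : (r%:E < limit_times j.+1)%E by apply: lt_trans rhj; rewrite lte_fin.
have jrh : (limit_times j < (r + h)%:E)%E by apply: lt_trans jr _; rewrite lte_fin.
have dom_r := interior_dom jr rj; have dom_rh := interior_dom jrh rhj.
have cst_cvg (u e' : R) : 0 < e' -> \forall k \near U, `|u - u| < e'.
  by move=> e'0; apply: nearW => k; rewrite subrr normr0.
have val_r := limit_arc_value dom_r (cst_cvg r) e0.
have val_rh := limit_arc_value dom_rh (cst_cvg (r + h)) e0.
pose T := `|r + h| + j%:R + 1.
have T0 : 0 < T by rewrite ltr_wpDl ?addr_ge0.
have [k [[d1 d2] [[v1 v2] [lk fk]]]] := near_ex UU (near_and UU
  (near_and UU dom_r dom_rh) (near_and UU (near_and UU val_r val_rh)
  (near_and UU (lipx T0) (approximation_flow e0 T0)))).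
clear jr rhj rj jrh.
exists k; split => //.
have w1 : window k T (r, j).
  by split=> //=; rewrite /T; have := ler_norm (r + h); lra.
have w2 : window k T (r + h, j).
  by split=> //=; rewrite /T; have := ler_norm (r + h); lra.
have [ac fae] := fk r (r + h) j rh w1 w2; split => //.
apply: filterS fae; first exact: (ae_filter_ringOfSetsType lebesgue_measure).
move=> r' Hr' /[dup] /andP[rr' r'h] /Hr'[? ? ? wr']; split => //.
have h1 := lk _ _ _ wr' w1.
have h2 : L * `|r' - r| <= L * h.
  by rewrite ler_wpM2l// ger0_norm ?subr_ge0//; lra.
have := ler_distD (x k r j) (x k r' j) (phi r j); lra.
Qed.

(** An approximation is near the flow set at almost all times of a short interval
that starts at [r], in particular at one of them. *)
Lemma limit_arc_flow_set r t' j : (limit_times j < r%:E)%E -> r < t' ->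
  (t'%:E <= limit_times j.+1)%E -> flow_set H (phi r j).
Proof.
move=> jr rt' tj; have [[cC _] _ _ _ _] := basic.
apply: closed_approx cC _ => e e0.
have e30 : 0 < e / 3 by rewrite divr_gt0.
pose h := Num.min ((t' - r) / 2) (e / 3 / (L + 1)).
have h0 : 0 < h.
  by rewrite lt_min !divr_gt0 ?subr_gt0// ltr_wpDl.
have rht' : r + h < t'.
  have : h <= (t' - r) / 2 by rewrite ge_min lexx.
  lra.
have Lh : L * h <= e / 3.
  apply: (@le_trans _ _ ((L + 1) * h)); first by rewrite ler_wpM2r ?(ltW h0)// lerDl.
  by rewrite mulrC -ler_pdivlMr ?ltr_wpDl// ge_min lexx orbT.
have rhj : ((r + h)%:E < limit_times j.+1)%E.
  by apply: lt_le_trans tj; rewrite lte_fin.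
have [k [_ _ [_ fae]]] := interior_approximation h0 e30 jr rhj.
have [|r' _ [Cr' _ _ xr']] := ae_exists _ fae; first by rewrite ltrDl.
have [c Cc xc] := inflate_dist (ltW e30) Cr'; exists c => //.
rewrite distrC in xc.
have := ler_distD (x k r' j) c (phi r j); lra.
Qed.

(** On a short interval [[r, r + h]] an approximation stays near [phi r j], where
upper semicontinuity puts its velocities close to the convex set
[flow_map H (phi r j)]. By the mean value inequality its difference quotient is
close to that set, hence so is that of the limit, and finally so is the
derivative. *)
Lemma limit_arc_flow_map r t' j : (limit_times j < r%:E)%E -> r < t' ->
  (t'%:E <= limit_times j.+1)%E -> derivable (phi^~ j) r 1 ->
  flow_map H (phi r j) (derive1 (phi^~ j) r).
Proof.
move=> jr rt' tj dr; have Cr := limit_arc_flow_set jr rt' tj.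
have [_ [oF bF] _ convF _] := basic.
have [[w0 Fw0] cF] := convF _ Cr.
apply: (outer_semicontinuous_graph oF) => e7 e70.
(* The errors, as multiples of [e * h]: 1 for the derivative of the limit, 2 for
   the distance to the approximation at both ends, 1 for the mean value
   inequality, 3 for the distance of its velocities to [flow_map H (phi r j)]. *)
pose e := e7 / 7; have e0 : 0 < e by rewrite divr_gt0.
have [d d0 Hd] := outer_semicontinuous_usc (phi r j) oF bF e0.
have [L1 HL1] := locally_bounded_bounded `|phi r j| bF.
have [d' d'0 Hd'] := derivable_increment dr e0.
pose h := Num.min (d' / 2) (Num.min ((t' - r) / 2) (d / 3 / (L + 1))).
have h0 : 0 < h.
  by rewrite !lt_min !divr_gt0 ?subr_gt0// ltr_wpDl.
have hd' : h < d'.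
  have : h <= d' / 2 by rewrite ge_min lexx.
  by move: d'0; lra.
have rht' : r + h < t'.
  have : h <= (t' - r) / 2 by rewrite !ge_min lexx orbT.
  by move: rt'; lra.
have Lh : L * h <= d / 3.
  apply: (@le_trans _ _ ((L + 1) * h)); first by rewrite ler_wpM2r ?(ltW h0)// lerDl.
  by rewrite mulrC -ler_pdivlMr ?ltr_wpDl// !ge_min lexx !orbT.
pose e' := Num.min (d / 3) (Num.min e (e * h)).
have e'0 : 0 < e' by rewrite !lt_min divr_gt0//= e0 mulr_gt0.
have e'd : e' <= d / 3 by rewrite ge_min lexx.
have e'e : e' <= e by rewrite !ge_min lexx orbT.
have e'h : e' <= e * h by rewrite !ge_min lexx !orbT.
have rhj : ((r + h)%:E < limit_times j.+1)%E.
  by apply: lt_le_trans tj; rewrite lte_fin.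
have [k [v1 v2 [ac fae]]] := interior_approximation h0 e'0 jr rhj.
pose S := [set v | exists2 w, flow_map H (phi r j) w & `|v - w| <= e].
have cS : convex S by exact: convex_nbhd.
pose S' := [set v | exists2 w, S w & `|v - w| <= e' + e].
have cS' : convex S' by exact: convex_nbhd.
have SF v : S' v -> exists2 w, flow_map H (phi r j) w & `|v - w| <= 3 * e.
  move=> [s [w Fw sw] vs]; exists w => //.
  by have := ler_distD s v w; lra.
have S'0 : S' w0.
  exists w0; last by rewrite subrr normr0; lra.
  by exists w0 => //; rewrite subrr normr0 ltW.
have S'b v : S' v -> `|v| <= L1 + 3 * e.
  move=> /SF[w Fw vw]; rewrite -(subrK w v).
  apply: le_trans (ler_normD _ _) _; rewrite addrC; apply: lerD => //.
  by apply: HL1 Fw.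
have fae' : {ae @lebesgue_measure R, forall r', r <= r' <= r + h ->
    derivable (fun t => x k t j) r' 1 /\ S' (derive1 (fun t => x k t j) r')}.
  apply: filterS fae; first exact: (ae_filter_ringOfSetsType lebesgue_measure).
  move=> r' Hr' /Hr'[_ dr' Fr' xr']; split => //.
  apply: inflation_flow_dist (ltW e'0) cS _ Fr' e0 => z zx _ v Fzv.
  have zr : `|z - phi r j| <= d.
    have := ler_distD (x k r' j) z (phi r j).
    by move: zx xr' e'd Lh; lra.
  have [w Fw vw] := Hd z v zr Fzv.
  by exists w.
have eh0 : 0 < e * h by rewrite mulr_gt0.
have rh : r < r + h by rewrite ltrDl.
have [s S's Hs] := mean_value_ae rh ac cS' S'0 S'b fae' eh0.
have [w Fw sw] := SF _ S's.
exists (phi r j), w; split => //; first by rewrite subrr normr0 ltW.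
have dh := Hd' h; rewrite (gtr0_norm h0) in dh; have {}dh := dh hd'.
rewrite distrC -(ler_pM2l h0) -{1}(gtr0_norm h0) -normrZ.
have -> : h *: (derive1 (phi^~ j) r - w) =
   - (phi (r + h) j - phi r j - h *: derive1 (phi^~ j) r)
   - (x k (r + h) j - phi (r + h) j) + (x k r j - phi r j)
   + (x k (r + h) j - x k r j - (r + h - r) *: s) + h *: (s - w).
  by apply/rowP => i; rewrite !mxE; ring.
have hsw : `|h *: (s - w)| <= h * (3 * e).
  by rewrite normrZ (gtr0_norm h0) ler_pM2l.
have e7E : h * e7 = 7 * (e * h) by rewrite /e; field.
apply: le_trans (ler_normD _ _) _.
apply: le_trans (lerD (ler_normD _ _) (lexx _)) _.
apply: le_trans (lerD (lerD (ler_normD _ _) (lexx _)) (lexx _)) _.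
apply: le_trans (lerD (lerD (lerD (ler_normB _ _) (lexx _)) (lexx _)) (lexx _)) _.
by rewrite normrN e7E; clear e7E; lra.
Qed.

Lemma limit_arc_flow t t' j : t < t' ->
  `[t, t']%classic `*` [set j] `<=` hdom phi ->
  {ae @lebesgue_measure R, forall r : R, t <= r <= t' ->
    [/\ flow_set H (phi r j), derivable (phi^~ j) r 1 &
        flow_map H (phi r j) (derive1 (phi^~ j) r)]}.
Proof.
move=> tt' sub.
have tj u : t <= u <= t' -> jump_domain limit_times (u, j).
  by move=> uI; apply: sub; split => //=; rewrite in_itv.
have jy : (limit_times j < +oo)%E.
  by apply: (@limit_times_fin t); apply: tj; rewrite lexx ltW.
have aed : {ae @lebesgue_measure R, forall r, derivable (phi^~ j) r 1}.
  by apply: (@lipschitz_ae_derivable_row _ _ _ L); exact: limit_arc_lipschitz.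
have aet (c : R) : {ae @lebesgue_measure R, forall r, r <> c}.
  exists [set c]; split => //; first exact: lebesgue_measure_set1.
  by move=> r /= /contrapT.
have aes : {ae @lebesgue_measure R, forall r,
    [/\ r <> t, r <> t' & derivable (phi^~ j) r 1]}.
  move: (aet t) (aet t') aed; apply: filterS3.
    exact: (ae_filter_ringOfSetsType lebesgue_measure).
  by move=> r ? ? ?.
apply: filterS aes; first exact: (ae_filter_ringOfSetsType lebesgue_measure).
move=> r [/eqP rt /eqP rt' dr] /andP[tr rt''].
have {rt}tr : t < r by rewrite lt_neqAle eq_sym rt.
have {rt' rt''}rt' : r < t' by rewrite lt_neqAle rt'.
have jt := tj t; have jt' := tj t'.
move: jt jt'; rewrite !lexx (ltW tt')/=.
move=> /(_ erefl) /andP[/= jt _] /(_ erefl) /andP[/= _ jt'].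
have jr : (limit_times j < r%:E)%E by apply: le_lt_trans jt _; rewrite lte_fin.
split => //; first exact: limit_arc_flow_set jr rt' jt'.
exact: limit_arc_flow_map jr rt' jt' dr.
Qed.

(** The jump times of the approximations converge to [t], and the values before
and after these jumps converge to the values of the limit. *)
Lemma limit_arc_jump t j : hdom phi (t, j) -> hdom phi (t, j.+1) ->
  jump_set H (phi t j) /\ jump_map H (phi t j) (phi t j.+1).
Proof.
move=> tj tj1.
have jt : limit_times j.+1 = t%:E.
  by apply/le_anti; case/andP: tj => _ /= ->; case/andP: tj1 => /= ->.
pose s k := fine (tau k j.+1).
have near_s e : 0 < e -> \forall k \near U, tau k j.+1 = (s k)%:E /\ `|s k - t| < e.
  move=> e0.
  have n1 : \forall k \near U, (tau k j.+1 < (t + e)%:E)%E.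
    by apply: (ulim_lt UU); rewrite -/(limit_times j.+1) jt lte_fin ltrDl.
  have n2 : \forall k \near U, ((t - e)%:E < tau k j.+1)%E.
    by apply: (ulim_gt UU); rewrite -/(limit_times j.+1) jt lte_fin ltrBlDr ltrDl.
  apply: filterS (near_and UU n1 n2) => k []; rewrite /s.
  case: (tau k j.+1) => // a; rewrite !lte_fin /= => h1 h2; split => //.
  by rewrite ltr_norml; apply/andP; split; lra.
have sE : \forall k \near U,
    jump_domain (tau k) (s k, j) /\ jump_domain (tau k) (s k, j.+1).
  apply: filterS (near_s 1 ltr01) => k [h _].
  by rewrite /jump_domain/= -h lexx !(htau k).2.
have s1 : \forall k \near U, jump_domain (tau k) (s k, j) by apply: filterS sE => k [].
have s2 : \forall k \near U, jump_domain (tau k) (s k, j.+1) by apply: filterS sE => k [].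
have st e : 0 < e -> \forall k \near U, `|s k - t| < e.
  by move=> /near_s; apply: filterS => k [].
have [[_ cD] _ [oG _] _ _] := basic.
have app e : 0 < e -> exists z w, [/\ jump_set H z, jump_map H z w,
    `|z - phi t j| <= e & `|w - phi t j.+1| <= e].
  move=> e0; have e20 : 0 < e / 2 by rewrite divr_gt0.
  pose T := `|t| + 1 + j.+1%:R.
  have T0 : 0 < T by rewrite ltr_wpDl// addr_ge0.
  have [k [[sol [sk1 sk2]] [stk [v1 v2]]]] := near_ex UU (near_and UU (near_and UU
    (approximation_solution e20 T0) sE) (near_and UU (st 1 ltr01)
    (near_and UU (limit_arc_value s1 st e20) (limit_arc_value s2 st e20)))).
  have sT : s k + j.+1%:R <= T.
    rewrite /T; have := ler_norm t; move: stk; rewrite ltr_norml => /andP[_].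
    by lra.
  have [_ _ _ jmp] := sol.
  have [||_ Gx] := jmp (s k) j.
  - by split => //=; apply: le_trans sT; rewrite lerD2l ler_nat.
  - by split.
  have [z [w [Dz Gzw zx wx]]] := inflation_jump_dist (ltW e20) Gx.
  rewrite /= in zx wx.
  exists z, w; split => //.
    by have := ler_distD (x k (s k) j) z (phi t j); move: zx v1; lra.
  by have := ler_distD (x k (s k) j.+1) w (phi t j.+1); move: wx v2; lra.
split.
  apply: closed_approx cD _ => e e0; have [z [w [Dz _ zt _]]] := app e e0.
  by exists z.
apply: (outer_semicontinuous_graph oG) => e e0.
have [z [w [_ Gzw zt wt]]] := app e e0.
by exists z, w.
Qed.

End lipschitz_limit.

End limit_arc.

(** Sequential compactness of solutions: the last two clauses say that the graphs
of the approximations converge to that of the limit, along [U]. *)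
Lemma solution_limit : exists phi : hybrid_map R n,
  [/\ is_solution H phi, complete_map phi,
      (forall (s : I -> R) j t,
         (\forall k \near U, jump_domain (tau k) (s k, j)) ->
         (forall e, 0 < e -> \forall k \near U, `|s k - t| < e) ->
         hdom phi (t, j) /\
         forall e, 0 < e -> \forall k \near U, `|x k (s k) j - phi t j| < e) &
      (forall t j, hdom phi (t, j) -> exists s : I -> R,
         (\forall k \near U, jump_domain (tau k) (s k, j)) /\
         (forall e, 0 < e -> \forall k \near U, `|s k - t| < e))].
Proof.
have [L L0 lipx] := approximation_lipschitz.
have /choice[f Hf] := limit_value_exists.
have f_cvg t j : (limit_times j < +oo)%E -> forall e, 0 < e ->
    \forall k \near U, `|x k (clamp (tau k) j t) j - f (t, j)| < e.
  exact: Hf (t, j).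
exists (HybridMap (jump_domain limit_times) (fun t j => f (t, j))); split.
- split.
  + split; first exact: jump_domain_hybrid limit_timesP.
    move=> t t' j tj _ _; have jy := limit_times_fin tj.
    apply: (@lipschitz_absolutely_continuous _ _ _ L) => //.
    exact: limit_arc_lipschitz.
  + exact: limit_arc_initial lipx.
  + by move=> t t' j; exact: limit_arc_flow lipx _ _ _.
  + exact: limit_arc_jump lipx.
- by move=> N; exact: jump_domain_unbounded limit_timesP.
- move=> s j t ds st; split; first exact: limit_arc_dom ds st.
  exact: limit_arc_value lipx _ _ _ ds st.
- exact: limit_arc_dom_seq.
Qed.

End solution_limit.

Section omega_limit.
Variables (R : realType) (n : nat) (psi : hybrid_map R n).

(** * The omega-limit set *)

Lemma omega_limitP (z : 'rV[R]_n) : omega_limit psi z <->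
  forall e N : R, 0 < e -> exists t j,
    [/\ hdom psi (t, j), N <= t + j%:R & `|psi t j - z| < e].
Proof.
split=> [[t [j [dtj tjy tjz]]] e N e0|Hz].
  have n1 : \forall k \near \oo, N <= t k + (j k)%:R by move/cvgryPge: tjy; exact.
  have n2 : \forall k \near \oo, `|psi (t k) (j k) - z| < e.
    by move/cvgr_distC_lt: tjz; exact.
  have [k [h1 h2]] := filter_ex (filterI n1 n2).
  by exists (t k), (j k).
have /choice[p Hp] : forall k : nat, exists p : R * nat,
    [/\ hdom psi p, k%:R <= p.1 + p.2%:R & `|psi p.1 p.2 - z| < k.+1%:R^-1].
  move=> k; have [|t [j [? ? ?]]] := Hz k.+1%:R^-1 k%:R; first by rewrite invr_gt0.
  by exists (t, j).
exists (fun k => (p k).1), (fun k => (p k).2); split.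
- by move=> k; rewrite -surjective_pairing; have [] := Hp k.
- apply/cvgryPge => N; near=> k; have [_ + _] := Hp k; apply: le_trans.
  near: k; exact: nbhs_infty_ger.
- apply/cvgrPdist_lt => e e0; near=> k; rewrite distrC.
  have [_ _ h] := Hp k; apply: lt_trans h _.
  near: k; exact: near_infty_natSinv_lt (PosNum e0).
Unshelve. all: by end_near. Qed.

Lemma omega_limit_nonempty : complete_map psi -> bounded_map psi ->
  omega_limit psi !=set0.
Proof.
move=> cpsi /bounded_setP[M HM].
have /choice[p Hp] : forall k : nat, exists p : R * nat,
    hdom psi p /\ k%:R < p.1 + p.2%:R.
  by move=> k; have [t [j ?]] := cpsi k%:R; exists (t, j).
have [U UU oU] := ultra_infty.
have [|z Hz] := @ultra_lim_row _ _ _ UU _ (fun k => psi (p k).1 (p k).2) M.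
  by apply: nearW => k; apply: HM; exists (p k) => //; have [] := Hp k.
exists z; apply/omega_limitP => e N e0.
have NU : \forall k \near U, N <= k%:R.
  by apply: oU; near=> k; near: k; exact: nbhs_infty_ger.
have [k [Nk ke]] := filter_ex (filterI NU (Hz e e0)).
have [dk lk] := Hp k; exists (p k).1, (p k).2; split => //.
  by rewrite -surjective_pairing.
by apply: le_trans Nk _; exact: ltW.
Unshelve. all: by end_near. Qed.

Lemma omega_limit_compact : bounded_map psi -> compact (omega_limit psi).
Proof.
move=> /bounded_setP[M HM]; apply: bounded_closed_compact.
  exists M; split; first exact: num_real.
  move=> M' MM' z /omega_limitP Hz.
  have [|t [j [dtj _ zt]]] := Hz (M' - M) 0; first by rewrite subr_gt0.
  have h : `|psi t j| <= M by apply: HM; exists (t, j).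
  rewrite /= -(subrK (psi t j) z); apply: le_trans (ler_normD _ _) _.
  by rewrite distrC; lra.
move=> z clz; apply/omega_limitP => e N e0.
have e20 : 0 < e / 2 by rewrite divr_gt0.
have [z' [/omega_limitP Kz' zz']] := clz _ (nbhsx_ballx z _ e20).
have [t [j [? ? h]]] := Kz' _ N e20.
exists t, j; split => //.
move: zz'; rewrite -ball_normE /= distrC => zz'.
by have := ler_distD z' (psi t j) z; lra.
Qed.

End omega_limit.

(** * Tails of psi and chains *)

Section invariant_solutions.
Variables (R : realType) (n : nat) (H : hybrid_inclusion R n) (K : set 'rV[R]_n).

(** The arcs used in all the chains: they belong to both classes of solutions that
the theorem is about. *)
Definition viable_solutions : set (hybrid_map R n) :=
  [set phi | [/\ is_solution H phi, complete_map phi &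
                 forall t j, hdom phi (t, j) -> K (phi t j)]].

Lemma viable_solutions_restriction :
  viable_solutions `<=` complete_solutions (restriction H K).
Proof.
move=> phi [[arc init flow jump] cphi Kphi]; split => //; split => //.
- have K0 : K (phi 0 0%N) by apply: Kphi; exact: hybrid_domain0 arc.1.
  by case: init => ?; [left|right].
- move=> t t' j tt' sub; apply: filterS (flow t t' j tt' sub).
    exact: (ae_filter_ringOfSetsType lebesgue_measure).
  move=> r Hr rtt'; have [? ? ?] := Hr rtt'; split => //; split => //.
  by apply: Kphi; apply: sub; split => //=; rewrite in_itv.
- move=> t j tj tj1; have [? ?] := jump t j tj tj1.
  by split; split => //; exact: Kphi.
Qed.

Lemma chain_transitiveS (L L' : set (hybrid_map R n)) : L `<=` L' ->
  internally_chain_transitive L K -> internally_chain_transitive L' K.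
Proof.
move=> LL' ctL x y T e Kx Ky T0 e0.
have [m [z [phi [t [j [m1 zx zy Hk]]]]]] := ctL x y T e Kx Ky T0 e0.
exists m, z, phi, t, j; split => // k km.
by have [[Lk zk] ? ? ? ?] := Hk k km; split => //; split => //; exact: LL'.
Qed.

End invariant_solutions.

Section tail_limits.
Variables (R : realType) (n : nat) (H : hybrid_inclusion R n).
Hypothesis basic : hybrid_basic_conditions H.
Variable psi : hybrid_map R n.
Hypothesis vis : vanishing_inflation_solution H psi.
Local Notation K := (omega_limit psi).

Lemma vanishing_jump_times : exists2 tau, jump_times tau & hdom psi = jump_domain tau.
Proof. by have [[hd _] cpsi _ _] := vis; exact: complete_domainP. Qed.

(** The basic tool: psi between two late times [(s k, i k)] and [(s' k, i' k)]
converges to a complete solution in the omega-limit set. The perturbation is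
small on bounded windows, so the limit of the perturbed tails is a limit of the
tails themselves. *)
Lemma tail_limit (U : set_system nat) (s s' : nat -> R) (i i' : nat -> nat) (a b : R) :
  UltraFilter U ->
  (forall k, hdom psi (s k, i k)) -> (forall k, hdom psi (s' k, i' k)) ->
  (forall N, \forall k \near U, N <= s k + (i k)%:R) -> 0 <= a ->
  (forall k, a <= (s' k + (i' k)%:R) - (s k + (i k)%:R) <= b) ->
  exists phi t j, [/\ viable_solutions H K phi, hdom phi (t, j), a <= t + j%:R,
    (forall e, 0 < e -> \forall k \near U, `|psi (s k) (i k) - phi 0 0%N| < e) &
    (forall e, 0 < e -> \forall k \near U, `|psi (s' k) (i' k) - phi t j| < e)].
Proof.
move=> UU dp dq pinf a0 ab.
have [T hT dE] := vanishing_jump_times.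
have [_ _ /bounded_setP[M HM] [chi [_ vchi] solchi]] := vis.
pose tau k j := Order.max 0%E (T (i k + j)%N - (s k)%:E)%E.
have tauP k : jump_times (tau k) /\ forall t j, jump_domain (tau k) (t, j) <->
    0 <= t /\ hdom psi (s k + t, (i k + j)%N).
  by rewrite dE; apply: tail_jump_domain => //; rewrite -dE.
have htau k := (tauP k).1.
pose x k t j := psi (s k + t) (i k + j)%N + chi (s k) (i k) (s k + t) (i k + j)%N.
have tailE k : hdom (tail psi (s k) (i k)) = jump_domain (tau k).
  apply/seteqP; split => -[t j].
    by move=> h; apply/(tauP k).2.
  by move/(tauP k).2.
have sol e N : 0 < e -> 0 < N -> \forall k \near U,
    is_solution (inflation H e) (HybridMap (window tau k N) (x k)).
  move=> e0 N0; have [kappa _ Hk] := solchi e N e0 N0.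
  apply: filterS (pinf kappa) => k /(Hk _ _ (dp k)).
  by rewrite tailE.
have chi_small N e : 0 < e -> \forall k \near U, forall t j, window tau k N (t, j) ->
    `|x k t j - psi (s k + t) (i k + j)%N| < e.
  move=> e0; have N0 : 0 < `|N| + 1 by rewrite ltr_wpDl.
  have [kappa Hk] := vchi _ N0 e e0.
  apply: filterS (pinf kappa) => k /(Hk _ _ (dp k)) sup_e t j [/(tauP k).2[t0 dt] /= tN].
  rewrite /x addrAC subrr add0r; apply: le_lt_trans (norm_le_enorm _) _.
  rewrite -lte_fin; apply: le_lt_trans sup_e; apply: ereal_sup_ubound.
  have j0 : (0 : R) <= j%:R by [].
  exists (s k + t, (i k + j)%N) => //=; split.
    by split => //; rewrite natrD; lra.
  by rewrite natrD; have := ler_norm N; lra.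
have bx N : \forall k \near U, forall t j, window tau k N (t, j) -> `|x k t j| <= M + 1.
  apply: filterS (chi_small N 1 ltr01) => k Hk t j wtj.
  rewrite -(subrK (psi (s k + t) (i k + j)%N) (x k t j)).
  apply: le_trans (ler_normD _ _) _; rewrite addrC; apply: lerD; last exact/ltW/Hk.
  by apply: HM; case: wtj => /(tauP k).2[_ ?] _; exists (s k + t, (i k + j)%N).
have [phi [sphi cphi phi_cvg phi_seq]] := solution_limit basic UU htau bx sol.
have psi_cvg r j t : (\forall k \near U, jump_domain (tau k) (r k, j)) ->
    (forall e, 0 < e -> \forall k \near U, `|r k - t| < e) ->
    hdom phi (t, j) /\
    forall e, 0 < e -> \forall k \near U, `|psi (s k + r k) (i k + j)%N - phi t j| < e.
  move=> dr rt; have [dphi Hphi] := phi_cvg r j t dr rt; split => // e e0.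
  have e20 : 0 < e / 2 by rewrite divr_gt0.
  have n1 := near_and UU (near_and UU dr (rt 1 ltr01))
    (near_and UU (chi_small (t + 1 + j%:R) _ e20) (Hphi _ e20)).
  apply: filterS n1 => k [[dk rk] [ck pk]].
  have wk : window tau k (t + 1 + j%:R) (r k, j).
    split => //=; move: rk; rewrite ltr_norml => /andP[_]; lra.
  have := ck _ _ wk; rewrite distrC => {}ck.
  have := ler_distD (x k (r k) j) (psi (s k + r k) (i k + j)%N) (phi t j); lra.
have Kphi t j : hdom phi (t, j) -> K (phi t j).
  move=> /phi_seq[r [dr rt]]; have [_ Hphi] := psi_cvg r j t dr rt.
  apply/omega_limitP => e N e0.
  have [k [[dk Nk] pk]] :=
    near_ex UU (near_and UU (near_and UU dr (pinf N)) (Hphi e e0)).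
  have [r0 dpsi] := ((tauP k).2 _ _).1 dk.
  exists (s k + r k), (i k + j)%N; split => //.
  by rewrite natrD; have : (0 : R) <= j%:R by []; lra.
have sorted k : s k <= s' k /\ (i k <= i' k)%N.
  apply: (jump_domain_sorted hT); [by rewrite -dE|by rewrite -dE|].
  by have /andP[] := ab k; lra.
pose jn k := (i' k - i k)%N; pose tn k := s' k - s k.
have tnE k : s' k = s k + tn k by rewrite /tn; lra.
have jnE k : i' k = (i k + jn k)%N by rewrite subnKC//; have [] := sorted k.
have abk k : a <= tn k + (jn k)%:R <= b.
  have := ab k; rewrite tnE jnE natrD => /andP[? ?]; apply/andP; split; lra.
have tn0 k : 0 <= tn k by rewrite subr_ge0; have [] := sorted k.
have b0 : 0 <= b by have /andP[h1 h2] := abk 0%N; exact: le_trans a0 (le_trans h1 h2).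
have [|j Hj] := @ultra_near_bounded_nat _ _ UU jn (Num.bound b).
  apply: nearW => k; rewrite -(ler_nat R); have /andP[_ h] := abk k.
  by have := archi_boundP b0; have := tn0 k; lra.
have [|t _ Ht] := @ultra_lim_itv _ _ _ UU tn 0 b.
  apply: nearW => k; rewrite tn0 /=; have /andP[_ h] := abk k.
  by have : (0 : R) <= (jn k)%:R by []; lra.
have [|dtj Htj] := psi_cvg tn j t _ Ht.
  apply: filterS Hj => k jk; apply/(tauP k).2; split => //.
  by rewrite -tnE -jk -jnE.
exists phi, t, j; split => //.
- apply/ler_addgt0Pr => e e0.
  have [k [jk tk]] := near_ex UU (near_and UU Hj (Ht e e0)).
  have /andP[h _] := abk k; rewrite jk in h.
  by move: tk; rewrite ltr_norml => /andP[_]; lra.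
- have [||_ H0] := psi_cvg (fun=> 0) 0%N 0.
  + apply: nearW => k; apply/(tauP k).2; rewrite addr0 addn0; split => //; exact: dp.
  + by move=> e e0; apply: nearW => k; rewrite subrr normr0.
  by move=> e e0; apply: filterS (H0 e e0) => k; rewrite addr0 addn0.
- move=> e e0; apply: filterS (near_and UU Hj (Htj e e0)) => k [jk].
  by rewrite -tnE -jk -jnE jk.
Qed.

Lemma vanishing_level N : 0 <= N ->
  exists t j, hdom psi (t, j) /\ N <= t + j%:R <= N + 1.
Proof.
have [T hT dE] := vanishing_jump_times; have [_ cpsi _ _] := vis.
move=> N0; have [t1 [j1 [d1 /ltW N1]]] := cpsi N; rewrite dE in d1 *.
exact: jump_domain_level N1.
Qed.

Lemma vanishing_level_ge0 t j : hdom psi (t, j) -> 0 <= t + j%:R.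
Proof.
by have [[hd _] _ _ _] := vis => /(hybrid_domain_ge0 hd) t0; rewrite addr_ge0.
Qed.

(** The tails start between [T] and [T + 1] before late times at which psi is
close to [x]; their limit passes through [x] at least [T] after its start. *)
Lemma omega_limit_weakly_invariant : weakly_invariant H K.
Proof.
move=> x T /omega_limitP Kx T0.
have /choice[p Hp] : forall k : nat, exists p : (R * nat) * (R * nat),
   [/\ hdom psi p.1 /\ hdom psi p.2, `|psi p.2.1 p.2.2 - x| < k.+1%:R^-1,
    k%:R <= p.1.1 + p.1.2%:R &
    T <= (p.2.1 + p.2.2%:R) - (p.1.1 + p.1.2%:R) <= T + 1].
  move=> k; have [|t' [j' [d' N' x']]] := Kx k.+1%:R^-1 (k%:R + T + 1).
    by rewrite invr_gt0.
  have k0 : (0 : R) <= k%:R by [].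
  have [|t [j [d N]]] := @vanishing_level (t' + j'%:R - T - 1); first lra.
  exists ((t, j), (t', j')); move: N => /andP[N1 N2]; split => //=; first lra.
  by apply/andP; split; lra.
have [U UU oU] := ultra_infty.
have [|||||phi [t [j [[sphi cphi Kphi] dtj Ttj _ Hphi]]]] := @tail_limit U (fun k => (p k).1.1)
  (fun k => (p k).2.1) (fun k => (p k).1.2) (fun k => (p k).2.2) T (T + 1) UU.
- by move=> k; rewrite -surjective_pairing; have [[]] := Hp k.
- by move=> k; rewrite -surjective_pairing; have [[]] := Hp k.
- move=> N; apply: filterS (near_nat_ge N oU) => k /le_trans; apply.
  by have [] := Hp k.
- exact: ltW.
- by move=> k; have [] := Hp k.
exists phi; split => //; exists t, j; split => //.
apply: (ultralimit_unique UU Hphi) => e e0.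
apply: filterS (near_natSinv oU e0) => k; apply: lt_trans.
by have [] := Hp k.
Qed.

Section chains.
Variables (T e : R).

Definition link (L : set (hybrid_map R n)) (x y : 'rV[R]_n) := exists phi t j,
  [/\ L phi, phi 0 0%N = x, hdom phi (t, j), T <= t + j%:R & inflate [set phi t j] e y].

(** Chains as a transitive closure, which is the form suited to induction; the
indexed form is recovered in [linked_chain]. *)
Inductive linked L (x y : 'rV[R]_n) : Prop :=
| linked1 of link L x y
| linkedS w of link L x w & linked L w y.

Lemma linked_chain L x y : linked L x y ->
  (forall phi, L phi -> forall t j, hdom phi (t, j) -> K (phi t j)) ->
   exists (m : nat) (z : nat -> 'rV[R]_n) (phi : nat -> hybrid_map R n)
           (t : nat -> R) (j : nat -> nat),
      [/\ (1 <= m)%N, z 0%N = x, z m = y &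
          forall k, (k < m)%N ->
            [/\ L (phi k) /\ phi k 0 0%N = z k,
                hdom (phi k) (t k, j k),
                T <= t k + (j k)%:R,
                inflate [set phi k (t k) (j k)] e (z k.+1) &
                forall (r : R) (l : nat), hdom (phi k) (r, l) ->
                  r + l%:R <= t k + (j k)%:R -> K (phi k r l)]].
Proof.
move=> lxy LK; elim: lxy => {x y} [x y [phi [t [j [Lp p0 dtj Tt ey]]]]|
  x y w [phi [t [j [Lp p0 dtj Tt ey]]]] _ [m [z [phi' [t' [j' [m1 zw zy Hk]]]]]]].
  exists 1%N, (fun k => if k is 0%N then x else y), (fun=> phi), (fun=> t), (fun=> j).
  by split => // -[|//] _; split => // r l drl _; exact: LK.
exists m.+1, (fun k => if k is k'.+1 then z k' else x),
  (fun k => if k is k'.+1 then phi' k' else phi),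
  (fun k => if k is k'.+1 then t' k' else t),
  (fun k => if k is k'.+1 then j' k' else j); split => // -[_|k].
  by rewrite zw; split => // r l drl _; exact: LK drl.
by rewrite ltnS => /Hk.
Qed.
End chains.

(** By contradiction with [tail_limit]: every long enough late piece of psi is
shadowed at both ends by a complete solution in the omega-limit set. *)
Lemma uniform_shadowing (a b d : R) : 0 <= a -> 0 < d -> exists kappa : R,
  forall s i s' i', hdom psi (s, i) -> hdom psi (s', i') -> kappa <= s + i%:R ->
   a <= (s' + i'%:R) - (s + i%:R) <= b ->
   exists phi t j, [/\ viable_solutions H K phi, hdom phi (t, j), a <= t + j%:R,
     `|psi s i - phi 0 0%N| < d & `|psi s' i' - phi t j| < d].
Proof.
move=> a0 d0; apply: contrapT => nH.
have /choice[p Hp] : forall k : nat, exists p : (R * nat) * (R * nat),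
   [/\ hdom psi p.1 /\ hdom psi p.2, k%:R <= p.1.1 + p.1.2%:R,
    a <= (p.2.1 + p.2.2%:R) - (p.1.1 + p.1.2%:R) <= b &
    ~ exists phi t j, [/\ viable_solutions H K phi, hdom phi (t, j), a <= t + j%:R,
     `|psi p.1.1 p.1.2 - phi 0 0%N| < d & `|psi p.2.1 p.2.2 - phi t j| < d]].
  move=> k; apply: contrapT => nk; apply: nH; exists k%:R => s i s' i' dp dq ks ab.
  by apply: contrapT => nphi; apply: nk; exists ((s, i), (s', i')).
have [U UU oU] := ultra_infty.
have [|||||phi [t [j [vphi dtj atj H0 Htj]]]] := @tail_limit U (fun k => (p k).1.1)
  (fun k => (p k).2.1) (fun k => (p k).1.2) (fun k => (p k).2.2) a b UU.
- by move=> k; rewrite -surjective_pairing; have [[]] := Hp k.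
- by move=> k; rewrite -surjective_pairing; have [[]] := Hp k.
- move=> N; apply: filterS (near_nat_ge N oU) => k /le_trans; apply.
  by have [] := Hp k.
- exact: a0.
- by move=> k; have [] := Hp k.
have [k [h0 h1]] := near_ex UU (near_and UU (H0 d d0) (Htj d d0)).
by have [_ _ _] := Hp k; apply; exists phi, t, j.
Qed.

(** The chain follows psi from a late time near [x] to a later time near [y], in
steps of length between [T] and [2 * T + 1], each of which is shadowed by a
solution. The first solution must start exactly at [x]; it is the limit of the
tails that start at times where psi tends to [x]. *)
Lemma omega_limit_chain_transitive : internally_chain_transitive (viable_solutions H K) K.
Proof.
move=> x y T e /omega_limitP Kx /omega_limitP Ky T0 e0.
apply: linked_chain; last by move=> phi [].
(* Two errors of size [d] add up, and the Euclidean norm is at most [n] times the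
   max norm. *)
pose d := e / (2 * n.+1%:R).
have d0 : 0 < d by rewrite divr_gt0 ?mulr_gt0.
have near_inflate (u v w : 'rV[R]_n) : `|u - v| < d -> `|u - w| < d ->
    inflate [set v] e w.
  move=> uv uw; apply: (@dist_inflate _ _ _ _ _ v) => //.
  have h : `|w - v| <= 2 * d.
    by have := ler_distD u w v; rewrite (distrC w u); lra.
  apply: le_trans (ler_wpM2l _ h) _; first by [].
  rewrite /d mulrCA; apply: (@le_trans _ _ (n.+1%:R * (2 * (e / (2 * n.+1%:R))))).
    by rewrite mulrCA ler_wpM2r ?ler_nat// ltW// mulr_gt0.
  have: (n.+1%:R : R) != 0 by rewrite pnatr_eq0.
  move: (n.+1%:R : R) => c c0.
  by rewrite le_eqVlt; apply/orP; left; apply/eqP; field.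
have [kappa Hkappa] := uniform_shadowing (2 * T + 1) (ltW T0) d0.
(* [N] bounds the number of steps, since each of them takes at least [T]. *)
have finish N s i s' i' : hdom psi (s, i) -> hdom psi (s', i') ->
    kappa <= s + i%:R ->
    `|psi s' i' - y| < d -> T <= (s' + i'%:R) - (s + i%:R) <= N%:R * T ->
    exists2 w, `|psi s i - w| < d & linked T e (viable_solutions H K) w y.
  elim: N s i => [|N IH] s i dp dq ks qy /andP[Tlo Thi].
    by move: Thi; rewrite mul0r; lra.
  have [le|gt] := leP ((s' + i'%:R) - (s + i%:R)) (2 * T + 1).
    have [|phi [t [j [vphi dtj Ttj p0 p1]]]] := Hkappa _ _ _ _ dp dq ks.
      by rewrite Tlo.
    exists (phi 0 0%N) => //; apply: linked1; exists phi, t, j; split => //.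
    exact: near_inflate p1 qy.
  have [|s1 [i1 [d1 /andP[lo1 hi1]]]] := @vanishing_level (s + i%:R + T).
    by have := vanishing_level_ge0 dp; lra.
  have [|||||w w1 lw] := IH s1 i1 => //.
  - lra.
  - by apply/andP; split; [lra|move: Thi; rewrite -natr1 mulrDl mul1r; lra].
  have [|phi [t [j [vphi dtj Ttj p0 p1]]]] := Hkappa _ _ _ _ dp d1 ks.
    by apply/andP; split; lra.
  exists (phi 0 0%N) => //; apply: linkedS lw; exists phi, t, j; split => //.
  exact: near_inflate p1 w1.
have /choice[p Hp] : forall k : nat, exists p : (R * nat) * (R * nat),
   [/\ hdom psi p.1 /\ hdom psi p.2, `|psi p.1.1 p.1.2 - x| < k.+1%:R^-1,
    k%:R <= p.1.1 + p.1.2%:R &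
    T <= (p.2.1 + p.2.2%:R) - (p.1.1 + p.1.2%:R) <= T + 1].
  move=> k; have [|t [j [dp N' x']]] := Kx k.+1%:R^-1 k%:R.
    by rewrite invr_gt0.
  have [|t' [j' [dq N]]] := @vanishing_level (t + j%:R + T).
    by have := vanishing_level_ge0 dp; lra.
  exists ((t, j), (t', j')); move: N => /andP[N1 N2]; split => //=.
  by apply/andP; split; lra.
have [U UU oU] := ultra_infty.
have levels N : \forall k \near U, N <= (p k).1.1 + (p k).1.2%:R.
  apply: filterS (near_nat_ge N oU) => k /le_trans; apply.
  by have [] := Hp k.
have [|||||phi [t [j [vphi dtj Ttj H0 H1]]]] := @tail_limit U (fun k => (p k).1.1)
  (fun k => (p k).2.1) (fun k => (p k).1.2) (fun k => (p k).2.2) T (T + 1) UU.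
- by move=> k; rewrite -surjective_pairing; have [[]] := Hp k.
- by move=> k; rewrite -surjective_pairing; have [[]] := Hp k.
- exact: levels.
- exact: ltW.
- by move=> k; have [] := Hp k.
have phi0 : phi 0 0%N = x.
  apply: (ultralimit_unique UU H0) => e' e'0.
  apply: filterS (near_natSinv oU e'0) => k; apply: lt_trans.
  by have [] := Hp k.
have [k [kk kd]] := near_ex UU (near_and UU (levels kappa) (H1 d d0)).
have [[_ dq] _ _ /andP[lo _]] := Hp k.
set q := (p k).2 in dq kd lo.
have [s' [i' [d' N' y']]] := Ky d (q.1 + q.2%:R + T) d0.
pose N := Num.bound (((s' + i'%:R) - (q.1 + q.2%:R)) / T).
have [|||||w qw lw] := @finish N q.1 q.2 s' i' => //.
- by rewrite -surjective_pairing.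
- lra.
- apply/andP; split; first lra.
  rewrite -ler_pdivrMr// ltW//; apply: archi_boundP; rewrite divr_ge0 ?ltW//; lra.
apply: linkedS lw; exists phi, t, j; split => //.
exact: near_inflate kd qw.
Qed.

End tail_limits.

Theorem corollary4p8 (R : realType) (n : nat)
    (C : set 'rV[R]_n) (F : 'rV[R]_n -> set 'rV[R]_n)
    (D : set 'rV[R]_n) (G : 'rV[R]_n -> set 'rV[R]_n)
    (psi : hybrid_map R n) :
  let H := HybridInclusion C F D G in
  let K := omega_limit psi in
  hybrid_basic_conditions H ->
  vanishing_inflation_solution H psi ->
  [/\ K !=set0, compact K, weakly_invariant H K,
      internally_chain_transitive (solutions H) K &
      internally_chain_transitive (complete_solutions (restriction H K)) K].
Proof.
move=> H K basic vis; have [_ cpsi bpsi _] := vis.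
have ct := omega_limit_chain_transitive basic vis.
split.
- exact: omega_limit_nonempty.
- exact: omega_limit_compact.
- exact: omega_limit_weakly_invariant.
- by apply: chain_transitiveS ct => phi [].
- by apply: chain_transitiveS ct; exact: viable_solutions_restriction.
Qed.
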